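(* The set $PD(\mathfrak{G})$ is invariant under the action of the group $WPE(\mathfrak{G})$, and hence splits into orbits. Let $H$ be the set of all vectors $h\in\mathbb{Z}^n$ with all components nonnegative that satisfy the equation of the secondary ellipsoid. Then the set of orbits of $WPE(\mathfrak{G})$ on $PD(\mathfrak{G})$ is in one-to-one correspondence with a subset of $H$, in such a way that for any $h\in H$ for which the vector $x_h=A^{-1}(\widetilde{1}-h)$ is integral, $h$ corresponds to an orbit and $x_h$ is the unique minimal vector of that orbit under the partial ordering $\le$.
   Context: Let $\mathfrak{G}$ be a complex semisimple Lie algebra of rank $n$, with a fixed Cartan subalgebra, root system $\Delta$, positive roots $\Delta^+$, and simple roots $\alpha_1,\dots,\alpha_n$. Let $A=(a_{ij})$ be the Cartan matrix and $A^{-1}=(b_{ij})$. Identify $\alpha_i$ with the standard basis vector $e_i$ of $\mathbb{R}^n$. Equip $\mathbb{R}^n$ with a (positive definite) inner product $\langle\cdot,\cdot\rangle$ such that $2\langle e_i,e_j\rangle/\langle e_i,e_i\rangle=a_{ij}$ for all $i,j$. The vertices of the Dynkin diagram carry weights $k_i\in\{1,2,3\}$: on each connected component the $k_i$ are proportional to the squared lengths of the simple roots, with minimum value $1$. The inner product is normalized so that $\langle e_i,e_i\rangle=k_i$ for all $i$. Let $\delta\in\mathbb{R}^n$ be the half-sum of all positive roots, and $\widetilde{1}=(1,\dots,1)$. Partially order $\mathbb{R}^n$ by $x\le y$ iff $x_i\le y_i$ for all $i$. The primary ellipsoid is $PE(\mathfrak{G})=\{x\in\mathbb{R}^n:\langle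 x,x-2\delta\rangle=0\}$; in coordinates its equation is $\sum_{i}k_i(x_i^2-x_i)-\sum_{i<j}l_{ij}x_ix_j=0$, where $l_{ij}=\max(k_i,k_j)$ if vertices $i,j$ of the Dynkin diagram are linked and $l_{ij}=0$ otherwise. $PD(\mathfrak{G})=PE(\mathfrak{G})\cap\mathbb{Z}^n$ is the set of its Diophantine (integer) solutions. The equation of the secondary ellipsoid is $\sum_{i}k_ib_{ii}(h_i^2-1)+2\sum_{i<j}k_ib_{ij}(h_ih_j-1)=0$, in the unknown $h=(h_1,\dots,h_n)$. For $x\in PE(\mathfrak{G})$ and $i\in\{1,\dots,n\}$, let $h^x_i$ be the (unique) nonzero real number such that $(x_1,\dots,x_i+h^x_i,\dots,x_n)\in PE(\mathfrak{G})$, if such a number exists, and $h^x_i=0$ otherwise. Let $T_i:PE(\mathfrak{G})\to PE(\mathfrak{G})$, $T_i(x)=(x_1,\dots,x_{i-1},x_i+h^x_i,x_{i+1},\dots,x_n)$. These are involutions, and $WPE(\mathfrak{G})$ is the group of bijections of $PE(\mathfrak{G})$ generated by $T_1,\dots,T_n$. A vector is called integral if all its components are integers. *)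

(* Defs.v *)
From HB Require Import structures.
From mathcomp Require Import all_boot all_order all_algebra.
From mathcomp Require Import boolp classical_sets functions fsbigop reals.
From mathcomp Require Import complex.

Set Implicit Arguments.
Unset Strict Implicit.
Unset Printing Implicit Defensive.

Import Order.TTheory GRing.Theory Num.Theory.

Local Open Scope ring_scope.
Local Open Scope classical_set_scope.
Local Open Scope complex_scope.

HB.mixin Record isLieAlgebra (F : fieldType) L of Vector F L := {
  lie_bracket : L -> L -> L;
  lie_bracket_linearl : forall (a : F) (x y z : L),
    lie_bracket (a *: x + y) z = a *: lie_bracket x z + lie_bracket y z;
  lie_bracket_linearr : forall (a : F) (x y z : L),
    lie_bracket x (a *: y + z) = a *: lie_bracket x y + lie_bracket x z;
  lie_bracketxx : forall x : L, lie_bracket x x = 0;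
  lie_jacobi : forall x y z : L,
    lie_bracket x (lie_bracket y z) + lie_bracket y (lie_bracket z x)
      + lie_bracket z (lie_bracket x y) = 0
}.

#[short(type="lieAlgType")]
HB.structure Definition LieAlgebra (F : fieldType) :=
  {L of isLieAlgebra F L & Vector F L}.

Section LieTheory.

Variables (F : fieldType) (L : lieAlgType F).
Implicit Types (x y : L) (U V I H : {vspace L}).

Definition lie_ideal I : Prop :=
  forall x y, y \in I -> lie_bracket x y \in I.

Definition lie_abelian U : Prop :=
  forall x y, x \in U -> y \in U -> lie_bracket x y = 0.

(* [U, V], the span of all brackets; by bilinearity bases of U and V suffice. *)
Definition lie_prod U V : {vspace L} :=
  <<[seq lie_bracket x y | x <- vbasis U, y <- vbasis V]>>%VS.

Definition lie_solvable U : Prop :=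
  exists m : nat, iter m (fun V => lie_prod V V) U = 0%VS.

Definition semisimple : Prop :=
  forall I, lie_ideal I -> lie_solvable I -> I = 0%VS.

Definition ad_diagonalizable x : Prop :=
  exists2 b : seq L, basis_of fullv b &
    forall y, y \in b -> exists a : F, lie_bracket x y = a *: y.

(* Cartan subalgebras of a complex semisimple Lie algebra: maximal abelian    *)
(* (i.e. abelian and equal to their own centralizer) with ad-diagonalizable   *)
(* elements.                                                                  *)
Definition cartan_subalgebra H : Prop :=
  [/\ lie_abelian H,
      forall x, (forall y, y \in H -> lie_bracket x y = 0) -> x \in H
    & forall x, x \in H -> ad_diagonalizable x].

(* Killing form: the trace of ad x \o ad y, computed in a basis of L.         *)
Definition killing x y : F :=
  \sum_(i < \dim {:L})
     coord (vbasis {:L}) i (lie_bracket x (lie_bracket y (vbasis {:L})`_i)).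

Section Roots.

Variable H : {vspace L}.

Local Notation dual := 'Hom(subvs_of H, F^o).

Definition is_root (phi : dual) : Prop :=
  phi != 0 /\
  exists2 x : L, x != 0 &
    forall h : subvs_of H, lie_bracket (vsval h) x = (phi h : F) *: x.

(* The vector of H representing phi with respect to the Killing form; it      *)
(* exists and is unique when L is semisimple.                                 *)
Definition killing_dual (phi : dual) : subvs_of H :=
  xget 0 [set t : subvs_of H |
            forall h : subvs_of H, killing (vsval t) (vsval h) = phi h].

Definition dual_form (phi psi : dual) : F :=
  killing (vsval (killing_dual phi)) (vsval (killing_dual psi)).

Section Base.

Variables (n : nat) (alpha : 'I_n -> dual).

Definition root_of_coords (c : 'cV[int]_n) : dual :=
  \sum_(i < n) (c i 0)%:~R *: alpha i.

Definition simple_roots : Prop :=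
  [/\ basis_of fullv [tuple alpha i | i < n],
      forall i, is_root (alpha i)
    & forall phi, is_root phi -> exists2 c : 'cV[int]_n,
        phi = root_of_coords c &
        (forall i, 0 <= c i 0) \/ (forall i, c i 0 <= 0)].

(* Positive roots in coordinates, alpha_i being the i-th basis vector.        *)
Definition positive_roots : set 'cV[int]_n :=
  [set c | is_root (root_of_coords c) /\ forall i, 0 <= c i 0].

Definition cartan_matrix : 'M[F]_n :=
  \matrix_(i, j) (2%:R * dual_form (alpha i) (alpha j)
                    / dual_form (alpha i) (alpha i)).

Definition dynkin_linked : rel 'I_n :=
  [rel i j | (i != j) && (cartan_matrix i j != 0)].

(* Proportionality of the weights to the squared lengths is written with      *)
(* cross-multiplication, for every pair of vertices in the same component.    *)
Definition dynkin_weights (k : 'I_n -> nat) : Prop :=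
  [/\ forall i, k i \in [:: 1; 2; 3]%N,
      forall i j, connect dynkin_linked i j ->
        (k i)%:R * dual_form (alpha j) (alpha j) =
        (k j)%:R * dual_form (alpha i) (alpha i)
    & forall i, exists2 j, connect dynkin_linked i j & k j = 1%N].

End Base.
End Roots.
End LieTheory.

Section Ellipsoid.

Variables (R : realType) (n : nat).
Implicit Types (x y : 'cV[R]_n).

Definition unit_vec (i : 'I_n) : 'cV[R]_n := delta_mx i 0.

Definition inner_product (ip : 'cV[R]_n -> 'cV[R]_n -> R) : Prop :=
  [/\ forall (a : R) x y z, ip (a *: x + y) z = a * ip x z + ip y z,
      forall x y, ip x y = ip y x
    & forall x, x != 0 -> 0 < ip x x].

(* The sum is over a finite set, L having finitely many roots.                *)
Definition half_sum_positive_roots (L : lieAlgType R[i]) (H : {vspace L})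
    (alpha : 'I_n -> 'Hom(subvs_of H, R[i]^o)) : 'cV[R]_n :=
  2%:R^-1 *: \sum_(c \in positive_roots alpha) (map_mx intr c : 'cV[R]_n).

Definition integral_vec x : Prop := forall i, x i 0 \is a Num.int.

Definition le_vec x y : Prop := forall i, x i 0 <= y i 0.

Definition minimal_in (O : set 'cV[R]_n) x : Prop :=
  O x /\ forall y, O y -> le_vec y x -> y = x.

Definition unique_minimal_in (O : set 'cV[R]_n) x : Prop :=
  minimal_in O x /\ forall y, minimal_in O y -> y = x.

Section WithForm.

Variables (ip : 'cV[R]_n -> 'cV[R]_n -> R) (delta : 'cV[R]_n).

Definition PE : set 'cV[R]_n := [set x | ip x (x - 2%:R *: delta) = 0].

Definition PD : set 'cV[R]_n := PE `&` integral_vec.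

(* h^x_i; xget returns its first argument when the set is empty.              *)
Definition step x (i : 'I_n) : R :=
  xget 0 [set h : R | h != 0 /\ PE (x + h *: unit_vec i)].

Lemma step_PE (x : PE) (i : 'I_n) :
  val x + step (val x) i *: unit_vec i \in PE.
Proof.
rewrite /step; case: xgetP => [h _ [_ PEh]|_]; first exact: mem_set.
by rewrite scale0r addr0; exact: valP.
Qed.

Definition Tmap (i : 'I_n) (x : PE) : PE :=
  exist (fun y => y \in PE) _ (step_PE x i).

(* The Tmap i being bijections of PE, this is the generated subgroup of the   *)
(* group of all bijections of PE.                                             *)
Inductive WPE : (PE -> PE) -> Prop :=
| WPE_gen i : WPE (Tmap i)
| WPE_id : WPE id
| WPE_comp f g : WPE f -> WPE g -> WPE (f \o g)
| WPE_inv f g : WPE f -> cancel f g -> cancel g f -> WPE g.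

Definition orbit_WPE (x : PE) : set 'cV[R]_n :=
  [set y | exists2 g : PE -> PE, WPE g & y = val (g x)].

Definition orbits_PD : set (set 'cV[R]_n) :=
  [set O | exists2 x : PE, PD (val x) & O = orbit_WPE x].

End WithForm.

Definition secondary_ellipsoid (A : 'M[R]_n) (k : 'I_n -> nat) (h : 'cV[R]_n)
    : Prop :=
  let b := invmx A in
  (\sum_(i < n) (k i)%:R * b i i * (h i 0 ^+ 2 - 1))
    + 2%:R * (\sum_(i < n) \sum_(j < n | (i < j)%N)
                (k i)%:R * b i j * (h i 0 * h j 0 - 1)) = 0.

Definition secondary_solutions (A : 'M[R]_n) (k : 'I_n -> nat)
    : set 'cV[int]_n :=
  [set h : 'cV[int]_n | (forall i, 0 <= h i 0) /\
                        secondary_ellipsoid A k (map_mx intr h)].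

Definition x_of (A : 'M[R]_n) (h : 'cV[int]_n) : 'cV[R]_n :=
  invmx A *m (const_mx 1 - map_mx intr h).

End Ellipsoid.

(* Main.v *)
Require Import Defs.
From HB Require Import structures.
From mathcomp Require Import all_boot all_order all_algebra.
From mathcomp Require Import boolp classical_sets functions fsbigop reals.
From mathcomp Require Import complex.
From mathcomp Require Import cardinality finmap zify ring lra.

Set Implicit Arguments.
Unset Strict Implicit.
Unset Printing Implicit Defensive.

Import Order.TTheory GRing.Theory Num.Theory.

Local Open Scope ring_scope.

(** Write [A] for the Cartan matrix, [s_i] for the simple reflection
    [y |-> y - (A y)_i e_i], and substitute [y = delta - x].  The primary
    ellipsoid becomes the sphere [<y, y> = <delta, delta>], on which [T_i] moves
    along [e_i] to the second point of intersection, that is, [T_i] is [s_i].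
    Hence [WPE] is the Weyl group acting on [delta - x], and the theorem follows
    from three properties of the root system:
    - [A] has integer entries;
    - [A delta = (1, ..., 1)];
    - [s_i] maps every positive root other than [e_i] to a positive root.

    The first two turn the displacement of [T_i] into [1 - (A x)_i]
    ([stepE]), an integer when [x] is integral, so [PD] is invariant.  The third
    gives the exchange property of words in the reflections ([exchange]), and
    from it [w u <= u] for every dominant [u] ([dominant_highest]).  So an orbit
    contains at most one [x] with [delta - x] dominant, and this [x] is below the
    whole orbit.  It exists because applying [T_i] while [1 - (A x)_i < 0]
    decreases the sum of the [k_i x_i], which equals [<x, x>] and so stays
    nonnegative ([orbit_dominant]).  The code of an orbit is
    [h = A (delta - x)] for its dominant [x]; [x] is recovered from [h], and the
    secondary ellipsoid is the image of the primary one under [x |-> h]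
    ([secondary_ellipsoidE]).

    The properties of the root system come from the sl2-triples of the simple
    roots.  The diagonal entries of [A] are 2, so no simple root has length zero
    for the Killing form; this makes the Killing form nondegenerate on [H], and
    its radical on [L] an ideal that meets [H] trivially.  Such an ideal
    is solvable by Engel's theorem, hence zero ([killing_radical_eq0]).  So the
    root spaces of [alpha_i] and [- alpha_i] pair nontrivially and yield a triple
    ([simple_root_triple]).  Representation theory of sl2 then shows that simple
    reflections preserve the roots, with integer Cartan numbers
    ([root_reflection]), and that no multiple [m alpha_i] with [m >= 2] is a root
    ([root_multiple]); the sign property of simple roots gives the permutation of
    the positive roots.  Finally [(A c)_i] changes sign under [s_i], so the sum of
    [(A c)_i] over the positive roots [c] reduces to the term of [e_i], which is
    2, whence [A delta = (1, ..., 1)] ([reflection_sum]). *)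

(** * Brackets and ad-diagonalizable elements *)

Section Bracket.
Variables (F : fieldType) (L : lieAlgType F).
Implicit Types (x y z : L) (U V W K : {vspace L}).

Local Notation br := (@lie_bracket F L).

HB.instance Definition _ x :=
  GRing.isLinear.Build F L L *:%R (br x)
    (fun a y z => lie_bracket_linearr a x y z).

Definition ad x : 'End(L) := linfun (br x).

Lemma adE x y : ad x y = br x y. Proof. exact: lfunE. Qed.

Lemma bracketC x y : br x y = - br y x.
Proof.
apply/eqP; rewrite -addr_eq0; apply/eqP.
have lin u v w : br (u + v) w = br u w + br v w.
  by rewrite -[u in LHS]scale1r lie_bracket_linearl scale1r.
have := lie_bracketxx (x + y).
by rewrite lin !linearD /= !lie_bracketxx add0r addr0 => <-.
Qed.

Lemma bracketDl x y z : br (x + y) z = br x z + br y z.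
Proof. by rewrite !(bracketC _ z) linearD opprD. Qed.

Lemma bracketZl a x z : br (a *: x) z = a *: br x z.
Proof. by rewrite !(bracketC _ z) linearZ scalerN. Qed.

Lemma bracketNl x z : br (- x) z = - br x z.
Proof. by rewrite !(bracketC _ z) linearN. Qed.

Lemma bracket0l z : br 0 z = 0.
Proof. by rewrite bracketC linear0 oppr0. Qed.

Lemma bracket_suml I (r : seq I) (P : pred I) (E : I -> L) z :
  br (\sum_(i <- r | P i) E i) z = \sum_(i <- r | P i) br (E i) z.
Proof.
by rewrite bracketC linear_sum -sumrN; apply: eq_bigr => i _; rewrite -bracketC.
Qed.

(** The Jacobi identity says that [ad x] is a derivation; this is the only form
    in which it is applied below. *)
Lemma bracket_derivation x y z : br x (br y z) = br (br x y) z + br y (br x z).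
Proof.
have := lie_jacobi x y z; rewrite (bracketC z (br x y)) (bracketC z x) linearN.
by move/eqP; rewrite subr_eq0 => /eqP <-; rewrite addrNK.
Qed.

Lemma iter_bracketD x n y z :
  iter n (br x) (y + z) = iter n (br x) y + iter n (br x) z.
Proof. by elim: n => //= n ->; rewrite linearD. Qed.

Lemma iter_bracket0 x n : iter n (br x) 0 = 0.
Proof. by elim: n => //= n ->; rewrite linear0. Qed.

Lemma mem_lie_prod U V x y : x \in U -> y \in V -> br x y \in lie_prod U V.
Proof.
move=> /coord_vbasis -> /coord_vbasis ->; rewrite bracket_suml memv_suml // => i _.
rewrite bracketZl memvZ // linear_sum memv_suml // => j _; rewrite linearZ memvZ //.
by apply/memv_span/allpairs_f; apply: mem_nth; rewrite size_tuple.
Qed.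

Lemma lie_prod_sub U V W :
  (forall x y, x \in U -> y \in V -> br x y \in W) -> (lie_prod U V <= W)%VS.
Proof.
move=> sUVW; apply/span_subvP => _ /allpairsP[[x y] /= [/vbasis_mem xU /vbasis_mem yV ->]].
exact: sUVW.
Qed.

Lemma lie_prodS U V U' V' :
  (U <= U')%VS -> (V <= V')%VS -> (lie_prod U V <= lie_prod U' V')%VS.
Proof.
move=> /subvP sU /subvP sV; apply: lie_prod_sub => x y xU yV.
by apply: mem_lie_prod; [apply: sU | apply: sV].
Qed.

End Bracket.

Section Diag.
Variables (F : fieldType) (L : lieAlgType F).
Local Notation br := (@lie_bracket F L).

(** Applying [ad h - a] kills the component [g a] and rescales the others by
    nonzero factors, so the components can be isolated in [W] one by one. *)
Lemma eigenvectors_in_stable (h : L) (W : {vspace L}) (es : seq F) (g : F -> L) :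
    (forall w, w \in W -> br h w \in W) -> uniq es ->
    (forall a, br h (g a) = a *: g a) ->
  \sum_(a <- es) g a \in W -> forall a, a \in es -> g a \in W.
Proof.
move=> hW; elim: es g => [|a es IHes] g //= /andP[a_es uniq_es] hg.
rewrite big_cons => sumW.
have esW b : b \in es -> g b \in W.
  move=> b_es; have ab : b - a != 0.
    by rewrite subr_eq0; apply: contraNneq a_es => <-.
  rewrite -[g b](scalerK ab) memvZ //.
  apply: (IHes (fun c => (c - a) *: g c) uniq_es) b_es.
    by move=> c; rewrite linearZ /= hg !scalerA mulrC.
  have <- : br h (g a + \sum_(j <- es) g j) - a *: (g a + \sum_(j <- es) g j)
      = \sum_(b <- es) (b - a) *: g b.
    rewrite linearD /= hg scalerDr opprD addrACA subrr add0r linear_sum scaler_sumr -sumrB.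
    by apply: eq_bigr => c _; rewrite /= hg scalerBl.
  by rewrite memvB ?memvZ ?sumW ?hW.
move=> b; rewrite inE => /predU1P[->|]; last exact: esW.
rewrite -[g a](addrK (\sum_(j <- es) g j)) memvB // big_seq memv_suml //.
Qed.

(** A stable subspace is spanned by the eigenvectors that it contains.  Stating
    this as an induction principle avoids carrying explicit decompositions. *)
Lemma eigenvector_ind (h : L) (W : {vspace L}) (P : L -> Prop) :
    ad_diagonalizable h -> (forall w, w \in W -> br h w \in W) ->
    P 0 -> (forall x y, P x -> P y -> P (x + y)) ->
    (forall a x, x \in W -> br h x = a *: x -> P x) ->
  forall x, x \in W -> P x.
Proof.
move=> [b basis_b diag_b] hW P0 PD Peig x xW.
pose ev y : F := xget 0 [set a | br h y = a *: y]%classic.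
have evE y : y \in b -> br h y = ev y *: y.
  by move=> /diag_b[a ha]; rewrite /ev; case: xgetP => // /(_ a).
pose c i := coord (in_tuple b) i x.
have xE : x = \sum_(i < size b) c i *: b`_i.
  by rewrite [LHS](coord_basis (X := in_tuple b) basis_b) ?memvf.
pose es := undup (map ev b).
(* The component of [x] for the eigenvalue [a]. *)
pose g a := \sum_(i < size b | ev b`_i == a) c i *: b`_i.
have xg : x = \sum_(a <- es) g a.
  rewrite (exchange_big_dep xpredT) //= {1}xE; apply: eq_bigr => i _.
  under eq_bigl => a do rewrite eq_sym.
  by rewrite -big_filter filter_pred1_uniq ?big_seq1 ?undup_uniq //
     mem_undup map_f ?mem_nth.
have hg a : br h (g a) = a *: g a.
  rewrite linear_sum scaler_sumr; apply: eq_bigr => i /eqP <-.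
  by rewrite linearZ /= evE ?mem_nth // !scalerA mulrC.
have gW a : a \in es -> g a \in W.
  by apply: (eigenvectors_in_stable hW (undup_uniq _) hg); rewrite -xg.
rewrite xg; elim: (es) gW => [|a r IHr] gW; first by rewrite big_nil.
rewrite big_cons; apply: PD; first exact: Peig (gW _ (mem_head _ _)) (hg a).
by apply: IHr => e e_r; rewrite gW // inE e_r orbT.
Qed.

Lemma eigenvalues_finite (h : L) : ad_diagonalizable h ->
  exists es : seq F, forall a x, x != 0 -> br h x = a *: x -> a \in es.
Proof.
move=> [b basis_b diag_b].
pose ev y : F := xget 0 [set a | br h y = a *: y]%classic.
have evE y : y \in b -> br h y = ev y *: y.
  by move=> /diag_b[a ha]; rewrite /ev; case: xgetP => // /(_ a).
exists (map ev b) => a x x0 hx.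
pose c i := coord (in_tuple b) i x.
have xE : x = \sum_(i < size b) c i *: b`_i.
  by rewrite [LHS](coord_basis (X := in_tuple b) basis_b) ?memvf.
case: (pickP (fun i => c i != 0)) => [i ci0|c0]; last first.
  move: x0; rewrite xE big1 ?eqxx // => i _.
  by move/negbFE/eqP: (c0 i) => ->; rewrite scale0r.
suff -> : a = ev b`_i by rewrite map_f ?mem_nth.
have free_b : free (in_tuple b) := basis_free basis_b.
have /(congr1 (coord (in_tuple b) i)) := hx.
rewrite linearZ /= -/(c i) {1}xE.
rewrite linear_sum (eq_bigr (fun j => (c j * ev b`_j) *: b`_j)); last first.
  by move=> j _; rewrite linearZ /= evE ?mem_nth // scalerA.
by rewrite coord_sum_free // mulrC => /(mulIf ci0).
Qed.

End Diag.

(** * Weight vectors of a Cartan subalgebra *)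

Section Weights.
Variables (F : numFieldType) (L : lieAlgType F) (H : {vspace L}).
Hypothesis H_cartan : cartan_subalgebra H.
Local Notation br := (@lie_bracket F L).
Local Notation dual := 'Hom(subvs_of H, F^o).
Implicit Types (x y z v w : L) (phi psi : dual) (U V W K : {vspace L}).

Definition weight_vector phi x : Prop :=
  forall h : subvs_of H, br (vsval h) x = (phi h : F) *: x.

Definition cartan_stable W : Prop :=
  forall h w, h \in H -> w \in W -> br h w \in W.

Lemma weight_vectorD phi x y :
  weight_vector phi x -> weight_vector phi y -> weight_vector phi (x + y).
Proof. by move=> xP yP h; rewrite linearD /= xP yP scalerDr. Qed.

Lemma weight_vectorZ phi a x : weight_vector phi x -> weight_vector phi (a *: x).
Proof. by move=> xP h; rewrite linearZ /= xP !scalerA mulrC. Qed.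

Lemma weight_vector_bracket phi psi x y :
  weight_vector phi x -> weight_vector psi y ->
  weight_vector (phi + psi) (br x y).
Proof.
move=> xP yP h; rewrite bracket_derivation xP yP bracketZl linearZ /=.
by rewrite -scalerDl add_lfunE.
Qed.

Lemma weight_vector_iter phi psi x y m :
  weight_vector phi x -> weight_vector psi y ->
  weight_vector (psi + phi *+ m) (iter m (br x) y).
Proof.
move=> xP yP; elim: m => [|m IHm]; first by rewrite addr0.
by rewrite mulrS addrCA; apply: weight_vector_bracket.
Qed.

Lemma lfun_mulrnE phi m h : (phi *+ m) h = (phi h : F) *+ m.
Proof. by elim: m => [|m IHm]; rewrite ?zero_lfunE // !mulrS add_lfunE IHm. Qed.

Lemma weight_vector0_cartan x : weight_vector 0 x -> x \in H.
Proof.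
move=> xP; case: H_cartan => _ + _; apply=> y yH.
rewrite bracketC; have := xP (vsproj H y).
by rewrite vsprojK // zero_lfunE scale0r => ->; rewrite oppr0.
Qed.

Lemma cartan_stable_full : cartan_stable fullv.
Proof. by move=> h w _ _; apply: memvf. Qed.

Lemma cartan_stable_line phi x : weight_vector phi x -> cartan_stable <[x]>.
Proof.
move=> xP h w hH /vlineP[a ->].
have := xP (vsproj H h); rewrite vsprojK // linearZ /= => ->.
by rewrite !memvZ ?memv_line.
Qed.

Lemma cartan_stable_add U V :
  cartan_stable U -> cartan_stable V -> cartan_stable (U + V).
Proof.
move=> HU HV h _ hH /memv_addP[u uU [v vV ->]].
by rewrite linearD memv_add ?HU ?HV.
Qed.

Lemma cartan_stable_prod U V :
  cartan_stable U -> cartan_stable V -> cartan_stable (lie_prod U V).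
Proof.
move=> HU HV h w hH wP.
suff sP : (lie_prod U V <= ad h @^-1: lie_prod U V)%VS.
  by move/subvP/(_ w wP): sP; rewrite -memv_preim adE.
apply: lie_prod_sub => x y xU yV; rewrite -memv_preim adE bracket_derivation.
by rewrite memvD // mem_lie_prod // ?HU ?HV.
Qed.

(** The elements of [H] commute, so the eigenspaces of one of them are stable
    under the others: adding one basis vector of [H] at a time to the list
    [hs] diagonalizes all of [H] simultaneously on [W]. *)
Lemma weight_vector_ind W (P : L -> Prop) : cartan_stable W ->
    P 0 -> (forall x y, P x -> P y -> P (x + y)) ->
    (forall phi x, x \in W -> weight_vector phi x -> P x) ->
  forall x, x \in W -> P x.
Proof.
move=> HW P0 PD Pwt.
have [abH _ diagH] := H_cartan.
suff joint (hs : seq L) : {subset hs <= H} -> forall V, cartan_stable V ->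
    (forall x, x \in V -> (forall h, h \in hs -> exists a, br h x = a *: x) -> P x) ->
    forall x, x \in V -> P x.
  apply: (joint (vbasis H)) => //; first by move=> h; apply: vbasis_mem.
  move=> x xW eig; pose ev h : F := xget 0 [set a | br h x = a *: x]%classic.
  have evE h : h \in (vbasis H : seq L) -> br h x = ev h *: x.
    by move=> /eig[a ha]; rewrite /ev; case: xgetP => // /(_ a).
  (* The eigenvalues on a basis of [H] extend linearly to a weight of [x]. *)
  pose f (h : subvs_of H) : F^o :=
    \sum_(i < \dim H) coord (vbasis H) i (vsval h) * ev (vbasis H)`_i.
  have f_lin : linear f.
    move=> a u v; rewrite /f scaler_sumr -big_split; apply: eq_bigr => i _ /=.
    have -> : coord (vbasis H) i (vsval (a *: u + v)) =
        a * coord (vbasis H) i (vsval u) + coord (vbasis H) i (vsval v).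
      by rewrite !linearP.
    by rewrite mulrDl -mulrA.
  pose fL := GRing.isLinear.Build _ _ _ _ f f_lin.
  pose fl : {linear subvs_of H -> F^o} := HB.pack f fL.
  apply: (Pwt (linfun fl)) => // h; rewrite lfunE /= /f.
  rewrite {1}(coord_vbasis (subvsP h)) bracket_suml scaler_suml.
  apply: eq_bigr => i _; rewrite bracketZl evE ?scalerA //.
  by rewrite mem_nth // size_tuple.
elim: hs => [|h hs IHhs] sH V HV PV x xV; first by apply: PV.
have hH : h \in H by rewrite sH ?mem_head.
apply: (eigenvector_ind (diagH h hH) _ P0 PD) xV => [w wV|a y yV hy].
  exact: HV.
pose E := (V :&: lker (ad h - a *: \1%VF)%R)%VS.
have mE w : w \in E = (w \in V) && (br h w == a *: w).
  rewrite memv_cap memv_ker add_lfunE opp_lfunE scale_lfunE id_lfunE adE.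
  by rewrite subr_eq0.
apply: (IHhs _ E) => [g g_hs|g w gH|z|]; first by rewrite sH // inE g_hs orbT.
- rewrite !mE => /andP[wV /eqP hw]; rewrite HV //=.
  by rewrite bracket_derivation (abH h g) // bracket0l add0r hw linearZ.
- rewrite mE => /andP[zV /eqP hz] eig; apply: PV => // g.
  by rewrite inE => /predU1P[->|/eig//]; exists a.
- by rewrite mE yV hy eqxx.
Qed.

Lemma dual_neq0P phi : phi != 0 -> exists h : subvs_of H, (phi h : F) != 0.
Proof.
move=> phi0; apply: contrapT => /forallNP all0; case/eqP: phi0.
apply/lfunP => h; rewrite zero_lfunE; apply/eqP.
by have /negP := all0 h; rewrite negbK.
Qed.

(** If [phi h <> 0], then [ad x] shifts the eigenvalues of [ad h] by [phi h], and
    the characteristic is 0: a nonzero string of iterates would produce more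
    distinct eigenvalues than [ad h] has. *)
Lemma weight_vector_nilpotent phi x : phi != 0 -> weight_vector phi x ->
  exists N, forall v, iter N (br x) v = 0.
Proof.
case: H_cartan => _ _ diagH.
move=> /dual_neq0P[h phih] xP; have diag_h := diagH _ (subvsP h).
have [es esP] := eigenvalues_finite diag_h.
exists (size es) => v.
apply: (eigenvector_ind (P := fun v => iter (size es) (br x) v = 0) diag_h) (memvf v).
- by move=> w _; apply: memvf.
- exact: iter_bracket0.
- by move=> u w u0 w0; rewrite iter_bracketD u0 w0 addr0.
move=> a w _ hw; apply: contrapT => /eqP Nw.
have eig j : br (vsval h) (iter j (br x) w) = (a + (phi h : F) *+ j) *: iter j (br x) w.
  elim: j => [|j IHj]; first by rewrite addr0.
  rewrite iterS bracket_derivation xP IHj bracketZl linearZ /= -scalerDl.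
  by rewrite mulrS addrCA.
have nz j : (j <= size es)%N -> iter j (br x) w != 0.
  move=> le_j; apply: contraNneq Nw => wj0.
  by rewrite -(subnK le_j) iterD wj0 iter_bracket0.
pose s := [seq a + (phi h : F) *+ j | j <- iota 0 (size es).+1].
have uniq_s : uniq s.
  by rewrite map_inj_uniq ?iota_uniq // => i j /addrI; apply: mulrIn.
suff /(uniq_leq_size uniq_s) : {subset s <= es} by rewrite size_map size_iota ltnn.
move=> _ /mapP[j + ->]; rewrite mem_iota add0n ltnS => /andP[_ le_j].
exact: esP (nz _ le_j) (eig _).
Qed.

End Weights.

(** * The Killing form and its radical *)

Section Killing.
Variables (F : fieldType) (L : lieAlgType F).
Local Notation br := (@lie_bracket F L).
Local Notation b := (vbasis {:L}).
Implicit Types x y z : L.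

(** The matrix of [ad x] for row vectors, hence the order of the products
    in the lemmas below. *)
Definition ad_mx x : 'M[F]_(\dim {:L}) := \matrix_(i, j) coord b j (br x b`_i).

Lemma coord_bracket2 x y (i k : 'I_(\dim {:L})) :
  coord b k (br x (br y b`_i)) = (ad_mx y *m ad_mx x) i k.
Proof.
rewrite !mxE {1}(coord_vbasis (memvf (br y b`_i))) !linear_sum /=.
by apply: eq_bigr => j _; rewrite !linearZ /= !mxE.
Qed.

Lemma killingE x y : killing x y = \tr (ad_mx y *m ad_mx x).
Proof. by apply: eq_bigr => i _; rewrite coord_bracket2. Qed.

Lemma ad_mx_bracket x y :
  ad_mx (br x y) = ad_mx y *m ad_mx x - ad_mx x *m ad_mx y.
Proof.
apply/matrixP => i k; have := bracket_derivation x y b`_i.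
move/(congr1 (coord b k)); rewrite [RHS]linearD /= !coord_bracket2 !mxE => ->.
by rewrite addrK.
Qed.

Lemma ad_mxP a x y : ad_mx (a *: x + y) = a *: ad_mx x + ad_mx y.
Proof.
by apply/matrixP => i j; rewrite !mxE bracketDl bracketZl linearP.
Qed.

Lemma killingC x y : killing x y = killing y x.
Proof. by rewrite !killingE mxtrace_mulC. Qed.

Lemma killing_invariant x y z : killing (br x y) z = killing x (br y z).
Proof.
rewrite !killingE !ad_mx_bracket mulmxBr mulmxBl !raddfB /= !mulmxA.
by rewrite [\tr (_ *m _ *m ad_mx y)]mxtrace_mulC mulmxA.
Qed.

Lemma killing_linearr a x y z : killing x (a *: y + z) = a * killing x y + killing x z.
Proof. by rewrite !killingE ad_mxP mulmxDl mxtraceD -scalemxAl mxtraceZ. Qed.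

Lemma killing_linearl a x y z : killing (a *: x + y) z = a * killing x z + killing y z.
Proof. by rewrite !(killingC _ z) killing_linearr. Qed.

Lemma killingDr x y z : killing x (y + z) = killing x y + killing x z.
Proof. by rewrite -[y]scale1r killing_linearr mul1r scale1r. Qed.

Lemma killing0r x : killing x 0 = 0.
Proof. by apply: (addrI (killing x 0)); rewrite -killingDr !addr0. Qed.

Lemma killingZr a x y : killing x (a *: y) = a * killing x y.
Proof. by rewrite -[a *: y]addr0 killing_linearr killing0r addr0. Qed.

Lemma killingZl a x y : killing (a *: x) y = a * killing x y.
Proof. by rewrite !(killingC _ y) killingZr. Qed.

(** The values of [killing x] on a basis, so that the radical of the Killing form
    is the kernel of a linear map. *)
Definition killing_row x : 'rV[F]_(\dim {:L}) := \row_i killing x b`_i.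

Lemma killing_row_linear : linear killing_row.
Proof. by move=> a x y; apply/rowP => i; rewrite !mxE killing_linearl. Qed.

HB.instance Definition _ :=
  GRing.isLinear.Build F L 'rV[F]_(\dim {:L}) *:%R killing_row killing_row_linear.

Definition killing_radical : {vspace L} := lker (linfun killing_row).

Lemma mem_killing_radical x :
  reflect (forall y, killing x y = 0) (x \in killing_radical).
Proof.
rewrite memv_ker lfunE /=; apply: (iffP eqP) => [/rowP x0 y|x0]; last first.
  by apply/rowP => i; rewrite !mxE.
rewrite (coord_vbasis (memvf y)).
elim/big_rec: _ => [|i u _ IHu]; first exact: killing0r.
by rewrite killing_linearr IHu addr0; have := x0 i; rewrite !mxE => ->; rewrite mulr0.
Qed.

Lemma killing_radical_ideal : lie_ideal killing_radical.
Proof.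
move=> x y /mem_killing_radical y0; apply/mem_killing_radical => z.
by rewrite bracketC -scaleN1r killingZl killing_invariant y0 mulr0.
Qed.

End Killing.

(** * Engel's theorem for subalgebras without Cartan part *)

Section Engel.
Variables (F : numFieldType) (L : lieAlgType F) (H : {vspace L}).
Hypothesis H_cartan : cartan_subalgebra H.
Local Notation br := (@lie_bracket F L).
Implicit Types (x y : L) (U V W K I : {vspace L}).

Local Notation lower K U j := (iter j (lie_prod K) U).

Definition lie_subalgebra K := forall x y, x \in K -> y \in K -> br x y \in K.

(** The descending chain [L], [[K, L]], [[K, [K, L]]], and so on, replaces the
    common kernel vectors of the usual proof of Engel's theorem. *)
Definition acts_nilpotently K := exists m, lower K fullv m = 0%VS.

Lemma iter_lie_prodS K K' U U' j : (K <= K')%VS -> (U <= U')%VS ->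
  (lower K U j <= lower K' U' j)%VS.
Proof. by move=> sK sU; elim: j => //= j IHj; apply: lie_prodS. Qed.

Lemma lower_decr K j : (lower K fullv j.+1 <= lower K fullv j)%VS.
Proof. by elim: j => [|j IHj]; rewrite ?subvf //= lie_prodS. Qed.

Lemma lower_stable K x j : (forall y, y \in K -> br x y \in K) ->
  forall v, v \in lower K fullv j -> br x v \in lower K fullv j.
Proof.
move=> xK; elim: j => [|j IHj] v /=; first by rewrite !memvf.
suff /subvP sP : (lower K fullv j.+1 <= ad x @^-1: lower K fullv j.+1)%VS.
  by move/sP; rewrite -memv_preim adE.
apply: lie_prod_sub => y w yK wP; rewrite -memv_preim adE bracket_derivation.
by rewrite memvD // mem_lie_prod // ?xK ?IHj.
Qed.

(** Each term [V j] of the chain of [K] is stable under [x], and [K] maps [V j]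
    into [V j.+1].  Modulo [V j.+1] only the powers of [ad x] survive in a product
    of elements of [K + <[x]>], so [N] factors descend from [V j] to [V j.+1]. *)
Lemma acts_nilpotently_extend K x :
    (forall y, y \in K -> br x y \in K) ->
    (exists N, forall v, iter N (br x) v = 0) ->
  acts_nilpotently K -> acts_nilpotently (K + <[x]>).
Proof.
move=> xK [N xN] [m Km].
pose V j := lower K fullv j.
have sVS j : (V j.+1 <= V j)%VS := lower_decr K j.
have xV j v : v \in V j -> br x v \in V j by apply: lower_stable.
have drop j U : (U <= V j)%VS -> (lower (K + <[x]>) U N <= V j.+1)%VS.
  move=> sU; suff mod_xr r u : u \in lower (K + <[x]>)%VS U r ->
      exists2 v, v \in V j & u - iter r (br x) v \in V j.+1.
    by apply/subvP => u /mod_xr[v _]; rewrite xN subr0.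
  have sl r' : (lower (K + <[x]>) U r' <= V j)%VS.
    elim: r' => [|r' IHr'] //=; apply: lie_prod_sub => k w.
    move=> /memv_addP[k1 k1K [_ /vlineP[a ->] ->]].
    move/(subvP IHr') => wV.
    by rewrite bracketDl bracketZl memvD ?memvZ ?xV // (subvP (sVS j)) // mem_lie_prod.
  elim: r u => [|r IHr] u; first by move=> /(subvP sU) uV; exists u; rewrite ?subrr ?mem0v.
  pose W := (V j.+1 + (ad x \o (iter r (fun f => ad x \o f) \1))%VF @: V j)%VS.
  have powE s v : (iter s (fun f => ad x \o f) \1)%VF v = iter s (br x) v.
    by elim: s => [|s IHs]; rewrite ?id_lfunE //= comp_lfunE IHs adE.
  suff /subvP sW : (lower (K + <[x]>) U r.+1 <= W)%VS.
    move=> /sW /memv_addP[w1 w1V [_ /memv_imgP[v vV ->] ->]].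
    by exists v => //; rewrite comp_lfunE adE powE addrK.
  apply: lie_prod_sub => k w /memv_addP[k1 k1K [_ /vlineP[a ->] ->]] wP.
  have wV := subvP (sl r) _ wP; have [v vV wv] := IHr _ wP.
  have xw : br x w = br x (w - iter r (br x) v) + br x (iter r (br x) v).
    by rewrite -linearD subrK.
  rewrite bracketDl bracketZl xw scalerDr addrA; apply: memv_add.
    by rewrite memvD ?memvZ ?xV // mem_lie_prod.
  rewrite memvZ // -iterS -powE iterS.
  exact: memv_img.
exists (N * m)%N; apply/eqP; rewrite -subv0 -Km.
elim: (m) => [|j IHj]; first by rewrite muln0.
by rewrite mulnS iterD; apply: drop.
Qed.

Lemma cartan_stable_lower K U j :
  cartan_stable H K -> cartan_stable H U -> cartan_stable H (lower K U j).
Proof. by move=> HK HU; elim: j => //= j IHj; apply: cartan_stable_prod. Qed.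

(** Since [K] acts nilpotently on [I], the chain [I], [[K, I]], and so on
    enters [K]; its last term outside [K] contains a weight vector [x] outside
    [K], and [[K, x]] lies in [K].  The weight of [x] is nonzero because [I]
    meets [H] trivially, so [ad x] is nilpotent and [K + <[x]>] is a larger
    candidate. *)
Lemma engel_step I K :
    cartan_stable H I -> lie_subalgebra I -> (H :&: I = 0)%VS ->
    (K <= I)%VS -> K != I ->
    cartan_stable H K -> lie_subalgebra K -> acts_nilpotently K ->
  exists K', [/\ (K' <= I)%VS, (\dim K < \dim K')%N, cartan_stable H K',
                 lie_subalgebra K' & acts_nilpotently K'].
Proof.
move=> HI brI HI0 sKI nKI HK brK nilK.
have [m Km] := nilK.
have exj : exists j, (lower K I j <= K)%VS.
  exists m; apply: subv_trans (iter_lie_prodS m (subvv K) (subvf I)) _.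
  by rewrite Km sub0v.
have [j jK minj] := ex_minnP exj; case: j jK minj => [sIK|j sUK minj].
  by rewrite eqEsubv sKI sIK in nKI.
have sUI : (lower K I j <= I)%VS.
  elim: (j) => //= i IHi; apply: lie_prod_sub => y z /(subvP sKI) yI /(subvP IHi).
  exact: brI.
have [phi [x [xU xP xK]]] : exists phi x,
    [/\ x \in lower K I j, weight_vector (H := H) phi x & x \notin K].
  apply: contrapT => no; suff sUjK : (lower K I j <= K)%VS.
    by have := minj j sUjK; rewrite ltnn.
  apply/subvP; apply: (weight_vector_ind H_cartan (cartan_stable_lower HK HI)).
  - exact: mem0v.
  - exact: memvD.
  move=> phi x xU xP; apply: contrapT => /negP xK; apply: no; by exists phi, x.
have phi0 : phi != 0.
  apply: contraNneq xK => phi0; rewrite phi0 in xP.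
  have : x \in (H :&: I)%VS.
    by rewrite memv_cap (weight_vector0_cartan H_cartan xP) (subvP sUI).
  by rewrite HI0 memv0 => /eqP->; apply: mem0v.
have Kx y : y \in K -> br y x \in K by move=> yK; apply/(subvP sUK)/mem_lie_prod.
have xKK y : y \in K -> br x y \in K by move=> /Kx; rewrite bracketC memvN.
exists (K + <[x]>)%VS; split.
- by rewrite subv_add sKI -memvE (subvP sUI).
- have xnz : x != 0 by apply: contraNneq xK => ->; apply: mem0v.
  rewrite dimv_disjoint_sum ?dim_vline ?xnz ?addn1 //.
  apply/eqP; rewrite -subv0; apply/subvP => y; rewrite memv_cap => /andP[yK /vlineP[a ya]].
  have [a0|a0] := eqVneq a 0; first by rewrite ya a0 scale0r mem0v.
  by case/negP: xK; rewrite -[x](scalerK a0) -ya memvZ.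
- by apply: cartan_stable_add => //; apply: cartan_stable_line xP.
- move=> _ _ /memv_addP[k kK [_ /vlineP[a ->] ->]] /memv_addP[l lK [_ /vlineP[c ->] ->]].
  apply: (subvP (addvSl _ _)).
  rewrite bracketDl bracketZl !linearD /= ![lie_bracket _ (c *: x)]linearZ /=.
  rewrite lie_bracketxx !scaler0 addr0.
  by rewrite !memvD ?memvZ ?(brK k l) ?Kx ?xKK.
- by apply: acts_nilpotently_extend => //; apply: weight_vector_nilpotent xP.
Qed.

(** Engel's theorem for a subalgebra spanned by vectors of nonzero weight: its
    weight vectors are [ad]-nilpotent, although its other elements are not known
    to be so beforehand. *)
Lemma engel I : cartan_stable H I -> lie_subalgebra I -> (H :&: I = 0)%VS ->
  acts_nilpotently I.
Proof.
move=> HI brI HI0.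
suff /(_ (\dim I).+1)[K [sKI _ _ nilK [|/eqP <- //]]] : forall d, exists K,
    [/\ (K <= I)%VS, cartan_stable H K, lie_subalgebra K, acts_nilpotently K
      & (d <= \dim K)%N \/ K == I].
  by rewrite ltnNge dimvS.
elim=> [|d [K [sKI HK brK nilK [le_d|/eqP KI]]]].
- exists 0%VS; split; rewrite ?sub0v //; last by left.
  + by move=> h w _; rewrite memv0 => /eqP->; rewrite linear0 mem0v.
  + by move=> w w'; rewrite !memv0 => /eqP-> _; rewrite bracket0l.
  + exists 1%N; apply/eqP; rewrite -subv0; apply: lie_prod_sub => x y.
    by rewrite memv0 => /eqP-> _; rewrite bracket0l mem0v.
- have [KI|nKI] := eqVneq K I; first by exists K; split => //; right; apply/eqP.
  have [K' [sK' lt_d HK' brK' nilK']] := engel_step HI brI HI0 sKI nKI HK brK nilK.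
  by exists K'; split=> //; left; apply: leq_ltn_trans lt_d.
- by exists K; split=> //; right; apply/eqP.
Qed.

(** The derived series of [I] is dominated by the chain of [I] on [L]. *)
Lemma acts_nilpotently_solvable I :
  lie_subalgebra I -> acts_nilpotently I -> lie_solvable I.
Proof.
move=> brI [m Im]; exists m; apply/eqP; rewrite -subv0 -Im.
pose D j := iter j (fun V => lie_prod V V) I.
have sDI j : (D j <= I)%VS.
  by elim: j => //= j IHj; apply: subv_trans (lie_prodS IHj IHj) _; apply: lie_prod_sub.
by elim: (m) => [|j IHj] /=; [apply: subvf | apply: lie_prodS (sDI j) IHj].
Qed.

End Engel.

(** * Representations of sl2 and root strings *)

Section Sl2.
Variables (F : numFieldType) (L : lieAlgType F).
Local Notation br := (@lie_bracket F L).
Variables (e f h : L).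
Hypotheses (ef : br e f = h) (hf : br h f = - 2%:R *: f).

Lemma sl2_weight lam v j : br h v = lam *: v ->
  br h (iter j (br f) v) = (lam - 2%:R * j%:R) *: iter j (br f) v.
Proof.
move=> hv; elim: j => [|j IHj]; first by rewrite mulr0 subr0.
rewrite iterS bracket_derivation hf IHj bracketZl linearZ /= -scalerDl.
by congr (_ *: _); rewrite -[j.+1]addn1 natrD; ring.
Qed.

Lemma sl2_ladder lam v j : br h v = lam *: v -> br e v = 0 ->
  br e (iter j.+1 (br f) v) = (j.+1%:R * (lam - j%:R)) *: iter j (br f) v.
Proof.
move=> hv ev; elim: j => [|j IHj].
  by rewrite /= bracket_derivation ef ev linear0 addr0 hv mul1r subr0.
rewrite iterS bracket_derivation ef (sl2_weight _ hv) IHj linearZ /= -scalerDl.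
by congr (_ *: _); rewrite -[j.+2]addn1 -[j.+1]addn1 !natrD; ring.
Qed.

(** At the last nonzero power [q] of the lowering operator, [sl2_ladder] reads
    [0 = (q + 1) (lam - q)], which forces [lam = q]. *)
Lemma sl2_highest lam v :
    v != 0 -> br h v = lam *: v -> br e v = 0 ->
    (exists N, iter N (br f) v = 0) ->
  exists2 q : nat, lam = q%:R & forall j, (j <= q)%N -> iter j (br f) v != 0.
Proof.
move=> v0 hv ev exN.
have [|N /eqP fN0 minN] := ex_minnP (P := fun N => iter N (br f) v == 0).
  by have [N /eqP] := exN; exists N.
case: N fN0 minN => [/eqP|q fq0 minq]; first by rewrite (negPf v0).
have nz j : (j <= q)%N -> iter j (br f) v != 0.
  by move=> le_j; apply/negP => /minq; rewrite ltnNge le_j.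
exists q => //; have := sl2_ladder q hv ev; rewrite fq0 linear0 => /esym/eqP.
by rewrite scaler_eq0 (negPf (nz q _)) // orbF mulf_eq0 pnatr_eq0 subr_eq0 => /eqP.
Qed.

End Sl2.

Section RootTriple.
Variables (F : numFieldType) (L : lieAlgType F) (H : {vspace L}).
Hypothesis H_cartan : cartan_subalgebra H.
Local Notation br := (@lie_bracket F L).
Local Notation dual := 'Hom(subvs_of H, F^o).
Implicit Types (alpha beta : dual) (e f v w : L) (h : subvs_of H).

(** An sl2-triple whose first two members are root vectors; the relations between
    [h], [e] and [f] follow from the weights and [alpha h = 2]. *)
Definition root_triple alpha e f h :=
  [/\ br e f = vsval h, weight_vector alpha e, weight_vector (- alpha) f
    & alpha h = 2%:R :> F].

Lemma root_triple_swap alpha e f h :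
  root_triple alpha e f h -> root_triple (- alpha) f e (- h).
Proof.
move=> [ef eP fP ah]; split=> //; last by rewrite opp_lfunE linearN opprK.
- by rewrite bracketC ef linearN.
- by rewrite opprK.
Qed.

Lemma root_triple_neq0 alpha e f h : root_triple alpha e f h -> alpha != 0.
Proof.
case=> _ _ _ ah; apply/eqP => a0; move/eqP: ah.
by rewrite a0 zero_lfunE eq_sym pnatr_eq0.
Qed.

Lemma root_triple_sl2 alpha e f h : root_triple alpha e f h ->
  br (vsval h) f = - 2%:R *: f.
Proof. by move=> [_ _ fP ah]; rewrite fP opp_lfunE ah. Qed.

Lemma root_triple_lower alpha e f h v : root_triple alpha e f h ->
  exists N, iter N (br f) v = 0.
Proof.
move=> tr; have [_ _ fP _] := tr.
have a0 : - alpha != 0 by rewrite oppr_eq0 (root_triple_neq0 tr).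
by have [N fN] := weight_vector_nilpotent H_cartan a0 fP; exists N.
Qed.

(** Raising [v] as far as possible reaches a highest weight vector, whose weight
    is the length [q] of its string. *)
Lemma root_string_top alpha e f h beta v : root_triple alpha e f h ->
    weight_vector beta v -> v != 0 ->
  exists p q : nat, exists w, [/\ weight_vector (beta + alpha *+ p) w,
    br e w = 0, beta h + (2 * p)%:R = q%:R :> F
    & forall j, (j <= q)%N -> iter j (br f) w != 0].
Proof.
move=> tr vP v0; have [ef eP fP ah] := tr.
have [|N /eqP eN0 minN] := ex_minnP (P := fun N => iter N (br e) v == 0).
  by have [N eN] := root_triple_lower v (root_triple_swap tr); exists N; apply/eqP.
case: N eN0 minN => [/eqP|p ep0 minp]; first by rewrite (negPf v0).
pose w := iter p (br e) v.
have w0 : w != 0 by apply/negP => /minp; rewrite ltnn.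
have wP : weight_vector (beta + alpha *+ p) w by apply: weight_vector_iter.
have hw : br (vsval h) w = (beta h + (2 * p)%:R : F) *: w.
  by rewrite wP add_lfunE lfun_mulrnE ah natrM mulr_natr.
have [q qE nz] := sl2_highest ef (root_triple_sl2 tr) w0 hw ep0 (root_triple_lower w tr).
by exists p, q, w.
Qed.

(** When the weight [z] of [v] is nonnegative, the string of length
    [q = z + 2 p] below the top vector, which lies [p] steps above [beta], reaches
    the mirror image [z] steps below [beta] after [z + p <= q] steps. *)
Lemma root_reflection_nat alpha e f h beta v : root_triple alpha e f h ->
    weight_vector beta v -> v != 0 ->
  exists2 z : int, beta h = z%:~R :> F &
    forall m : nat, z = m -> exists2 w, w != 0 & weight_vector (beta - alpha *+ m) w.
Proof.
move=> tr vP v0; have [_ _ fP _] := tr.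
have [p [q [w [wP ew qE nz]]]] := root_string_top tr vP v0.
exists (q%:Z - (2 * p)%:Z) => [|m /eqP].
  by rewrite intrB -!pmulrn -qE addrK.
rewrite subr_eq -PoszD eqz_nat => /eqP qm.
have le_q : (m + p <= q)%N by rewrite qm mul2n -addnn addnA leq_addr.
exists (iter (m + p) (br f) w); first exact: nz.
have := weight_vector_iter (m + p) fP wP.
by rewrite mulNrn mulrnDr opprD addrACA subrr addr0.
Qed.

(** A negative weight becomes positive for the triple with [e] and [f]
    exchanged. *)
Lemma root_reflection alpha e f h beta v : root_triple alpha e f h ->
    weight_vector beta v -> v != 0 ->
  exists2 z : int, beta h = z%:~R :> F &
    exists2 w, w != 0 & weight_vector (beta - alpha *~ z) w.
Proof.
move=> tr vP v0; have [z zE zP] := root_reflection_nat tr vP v0.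
exists z => //; case: z zE zP => [m|m] zE zP; first exact: zP.
have [z' z'E /(_ m.+1)[|w w0 wP]] := root_reflection_nat (root_triple_swap tr) vP v0.
  by apply/eqP; rewrite -(eqr_int F) -z'E linearN /= zE NegzE mulrNz opprK.
by exists w => //; rewrite NegzE mulrNz opprK; rewrite mulNrn opprK in wP.
Qed.

(** A nonzero [v] killed by [f] would be a highest weight vector of weight [-2]
    for the exchanged triple. *)
Lemma root_triple_lower_inj alpha e f h v : root_triple alpha e f h ->
  weight_vector alpha v -> br f v = 0 -> v = 0.
Proof.
move=> tr vP fv; apply: contrapT => /eqP v0.
have tr' := root_triple_swap tr; have [fe _ eP ah] := tr'.
have hv : br (vsval (- h)) v = (- 2%:R) *: v.
  by rewrite vP linearN /=; have [_ _ _ ->] := tr.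
have [q /eqP + _] := sl2_highest fe (root_triple_sl2 tr') v0 hv fv (root_triple_lower v tr').
by rewrite eq_sym -subr_eq0 opprK -natrD pnatr_eq0 addn2.
Qed.

(** The hypothesis on [f] makes the root space of [alpha] a line, spanned by [e].
    Lowering a highest weight vector of weight a multiple of [alpha], at least
    twofold, ends in this line with a vector [u] killed by [e], whereas the ladder
    formula gives [e u] as a nonzero multiple of a nonzero vector. *)
Lemma root_multiple alpha e f h m v : root_triple alpha e f h ->
    (forall w, weight_vector alpha w -> exists a, br f w = a *: vsval h) ->
    weight_vector (alpha *+ m.+2) v -> v = 0.
Proof.
move=> tr fH vP; apply: contrapT => /eqP v0; have [ef eP fP ah] := tr.
have [p [q [w [wP ew qE nz]]]] := root_string_top tr vP v0.
(* The top vector [w] has weight [(r + 2) alpha]. *)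
pose r := (m + p)%N; rewrite -mulrnDr in wP.
have {}qE : q = (2 * r.+2)%N.
  apply/eqP; rewrite -(eqr_nat F) -qE lfun_mulrnE ah -[2%:R *+ _]mulr_natr -natrM -natrD.
  by rewrite -mulnDr !addSn.
have hw : br (vsval h) w = q%:R *: w.
  by rewrite wP lfun_mulrnE ah -[2%:R *+ _]mulr_natr -natrM qE !addSn.
pose u := iter r.+1 (br f) w.
have uP : weight_vector alpha u.
  have := weight_vector_iter r.+1 fP wP.
  by rewrite !addSn -/r (mulrS _ r.+1) mulNrn addrK.
have eu0 : br e u = 0.
  have [a fu] := fH u uP.
  have /eqP : u + a *: e = 0.
    apply: (root_triple_lower_inj tr); first by apply/weight_vectorD/weight_vectorZ.
    by rewrite linearD linearZ /= fu [br f e]bracketC ef scalerN subrr.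
  by rewrite addr_eq0 => /eqP ->; rewrite linearN linearZ /= lie_bracketxx scaler0 oppr0.
move: eu0; rewrite (sl2_ladder ef (root_triple_sl2 tr) r hw ew) => /eqP.
have le_rq : (r <= q)%N by rewrite qE mul2n -addnn !addSn -!addnS leq_addr.
rewrite scaler_eq0 (negPf (nz r le_rq)) orbF mulf_eq0 pnatr_eq0 /=.
by rewrite subr_eq0 eqr_nat qE mul2n -addnn gtn_eqF // !addSn ltnS ltnW // ltnS leq_addr.
Qed.

End RootTriple.

(** * Simple roots and positive roots *)

Section SimpleRoots.
Variables (F : numFieldType) (L : lieAlgType F) (H : {vspace L}).
Hypotheses (L_semisimple : semisimple L) (H_cartan : cartan_subalgebra H).
Local Notation br := (@lie_bracket F L).
Local Notation dual := 'Hom(subvs_of H, F^o).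
Variables (n : nat) (alpha : 'I_n -> dual).
Hypothesis alpha_simple : simple_roots alpha.
Hypothesis cartan_diag : forall i, cartan_matrix alpha i i = 2%:R.
Implicit Types (phi : dual) (h : subvs_of H) (c : 'cV[int]_n).

Local Notation t i := (killing_dual (alpha i)).

Lemma dual_form_neq0 i : dual_form (alpha i) (alpha i) != 0.
Proof.
have /eqP := cartan_diag i; rewrite mxE; apply: contraTneq => ->.
by rewrite mulr0 mul0r eq_sym pnatr_eq0.
Qed.

(** If no vector of [H] represented [alpha i], the default value 0 in
    [killing_dual] would make the length of [alpha i] vanish. *)
Lemma killing_dualP i h : killing (vsval (t i)) (vsval h) = alpha i h.
Proof.
have := dual_form_neq0 i; rewrite /dual_form /killing_dual.
by case: xgetP => [t _ tP //|_]; rewrite linear0 killing0r eqxx.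
Qed.

Lemma alpha_dual_form i j : alpha j (t i) = dual_form (alpha i) (alpha j) :> F.
Proof. by rewrite -killing_dualP killingC. Qed.

(** The simple roots span the dual of [H]. *)
Lemma simple_roots_separate h : (forall i, (alpha i h : F) = 0) -> h = 0.
Proof.
move=> ah0; have [basis_a _ _] := alpha_simple.
have phi0 phi : phi h = 0.
  rewrite (coord_basis basis_a (memvf phi)) sum_lfunE big1 // => i _.
  by rewrite scale_lfunE -tnth_nth tnth_mktuple ah0 scaler0.
rewrite (coord_vbasis (memvf h)) big1 // => i _.
have := phi0 (linfun (coord (vbasis fullv) i : {linear subvs_of H -> F^o})).
by rewrite lfunE /= => ->; rewrite scale0r.
Qed.

Lemma killing_cartan_nondegenerate x :
  x \in H -> (forall y, y \in H -> killing x y = 0) -> x = 0.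
Proof.
move=> xH x0; rewrite -(vsprojK xH) (_ : vsproj H x = 0) ?linear0 //.
apply: simple_roots_separate => i.
by rewrite -killing_dualP vsprojK // killingC x0 // subvsP.
Qed.

(** A vector of [H] in the radical is orthogonal to [H], hence zero.  So Engel's
    theorem applies to the radical, and a nonzero radical would be a solvable
    ideal. *)
Lemma killing_radical_eq0 : killing_radical L = 0%VS.
Proof.
have idR := @killing_radical_ideal F L.
apply: L_semisimple => //; apply: acts_nilpotently_solvable => [x y _|]; first exact: idR.
apply: (engel H_cartan) => [x y _|x y _|]; [exact: idR | exact: idR |].
apply/eqP; rewrite -subv0; apply/subvP => x; rewrite memv_cap memv0.
move=> /andP[xH /mem_killing_radical x0]; apply/eqP.
by apply: killing_cartan_nondegenerate.
Qed.

(** Both sides lie in [H], where the Killing form is nondegenerate, and by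
    invariance they have the same pairing with every element of [H]. *)
Lemma bracket_opposite i x y :
    weight_vector (alpha i) x -> weight_vector (- alpha i) y ->
  br x y = killing x y *: vsval (t i).
Proof.
move=> xP yP; have xyH : br x y \in H.
  apply: (weight_vector0_cartan H_cartan); rewrite -(subrr (alpha i)).
  exact: weight_vector_bracket.
apply/eqP; rewrite -subr_eq0; apply/eqP.
apply: killing_cartan_nondegenerate => [|z zH].
  by rewrite memvB ?memvZ ?subvsP.
have zP := killing_dualP i (vsproj H z); rewrite vsprojK // in zP.
rewrite addrC -scaleNr killing_linearl zP killing_invariant bracketC.
rewrite -[X in br X y](vsprojK zH) yP opp_lfunE scaleNr opprK killingZr.
by rewrite mulrC mulrN addNr.
Qed.

(** A root vector [e] is not in the radical, and by invariance it can pair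
    nontrivially with a weight vector only in weight [- alpha i].  The last clause
    is what [root_multiple] asks for. *)
Lemma simple_root_triple i : exists e f h,
  [/\ root_triple (alpha i) e f h,
      forall j, alpha j h = cartan_matrix alpha i j
    & forall w, weight_vector (alpha i) w -> exists a, br f w = a *: vsval h].
Proof.
have [_ /(_ i)[_ [e e0 eP]] _] := alpha_simple.
have [f fP ef] : exists2 f, weight_vector (- alpha i) f & killing e f != 0.
  apply: contrapT => no; case/eqP: e0; apply/eqP.
  rewrite -memv0 -killing_radical_eq0; apply/mem_killing_radical => y.
  apply: (weight_vector_ind (P := fun y => killing e y = 0) H_cartan
    (@cartan_stable_full _ _ H)) (memvf y).
  - exact: killing0r.
  - by move=> u v u0 v0; rewrite killingDr u0 v0 addr0.
  move=> phi u _ uP; apply: contrapT => /eqP eu; apply: no; exists u => //.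
  suff -> : - alpha i = phi by [].
  apply/lfunP => h; rewrite opp_lfunE; apply/eqP; rewrite eqr_oppLR -addr_eq0.
  have /eqP := killing_invariant e (vsval h) u.
  rewrite bracketC eP uP -scaleNr killingZl killingZr mulNr eq_sym -subr_eq0 opprK.
  by rewrite -mulrDl mulf_eq0 (negPf eu) orbF addrC.
have a0 : alpha i (t i) != 0 :> F by rewrite alpha_dual_form dual_form_neq0.
pose d : F := 2%:R / alpha i (t i).
exists e, ((d / killing e f) *: f), (d *: t i); split=> [|j|w wP].
- split=> //; last by rewrite linearZ /= /d -[_ *: _]/(_ * _) divfK.
  + rewrite linearZ /= (bracket_opposite eP fP) scalerA divfK // linearZ //.
  + exact: weight_vectorZ.
- rewrite linearZ /= !alpha_dual_form mxE -[_ *: _]/(_ * _) /d alpha_dual_form.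
  by rewrite mulrAC.
- exists (- (killing w f / killing e f)).
  rewrite bracketC linearZ /= (bracket_opposite wP fP) scalerA -scaleNr linearZ /= scalerA.
  by rewrite mulrN -mulrA [(killing e f)^-1 * _]mulrC.
Qed.

Lemma root_of_coordsE c h :
  root_of_coords alpha c h = \sum_(i < n) (c i 0)%:~R * alpha i h :> F.
Proof. by rewrite sum_lfunE; apply: eq_bigr => i _; rewrite scale_lfunE. Qed.

Lemma root_of_coordsB_delta c i (z : int) :
  root_of_coords alpha (c - z *: delta_mx i 0) = root_of_coords alpha c - alpha i *~ z.
Proof.
rewrite /root_of_coords.
under eq_bigr => j _ do rewrite !mxE intrB intrM scalerBl.
rewrite sumrB; congr (_ - _); rewrite (bigD1 i) //= !eqxx mulr1 scaler_int big1 ?addr0 //.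
by move=> j /negPf ji; rewrite ji mulr0 scale0r.
Qed.

Lemma root_of_coords0 : root_of_coords alpha 0 = 0.
Proof. by rewrite /root_of_coords big1 // => j _; rewrite mxE scale0r. Qed.

Lemma root_of_coords_delta i (z : int) :
  root_of_coords alpha (z *: delta_mx i 0) = alpha i *~ z.
Proof.
have := root_of_coordsB_delta 0 i (- z).
by rewrite root_of_coords0 !sub0r mulrNz scaleNr !opprK.
Qed.

Lemma root_of_coords_inj : injective (root_of_coords alpha).
Proof.
have [basis_a _ _] := alpha_simple; have free_a := basis_free basis_a.
pose X := [tuple alpha i | i < n].
have coordE c i : coord X i (root_of_coords alpha c) = (c i 0)%:~R.
  rewrite -[RHS](coord_sum_free (fun i => (c i 0)%:~R) i free_a).
  by congr (coord X i _); apply: eq_bigr => j _; rewrite -tnth_nth tnth_mktuple.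
move=> c c' cc'; apply/colP => i; apply: (@intr_inj F).
by rewrite -!coordE cc'.
Qed.

(** Reflecting cannot produce the zero weight: [phi = z alpha_i] would give
    [z = 2 z] on the coroot, hence [phi = 0]. *)
Lemma root_reflection_coords i c : is_root (root_of_coords alpha c) ->
  exists2 z : int, z%:~R = \sum_(j < n) cartan_matrix alpha i j * (c j 0)%:~R &
    is_root (root_of_coords alpha (c - z *: delta_mx i 0)).
Proof.
move=> [phi0 [v v0 vP]]; have [e [f [h [tr ah _]]]] := simple_root_triple i.
have [z zE [w w0 wP]] := root_reflection H_cartan tr vP v0.
exists z; first by rewrite -zE root_of_coordsE; apply: eq_bigr => j _; rewrite ah mulrC.
rewrite root_of_coordsB_delta; split; last by exists w.
apply: contraNneq phi0 => /eqP; rewrite subr_eq0 => /eqP phiE.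
rewrite phiE; move: zE; rewrite phiE -scaler_int scale_lfunE.
have [_ _ _ ->] := tr.
rewrite -[_ *: _]/(_ * _) => /eqP; rewrite -subr_eq0 -[X in _ - X]mulr1 -mulrBr.
rewrite mulf_eq0 intr_eq0 -[1]/1%:R -natrB // pnatr_eq0 orbF => /eqP ->.
by rewrite scale0r.
Qed.

Definition cartan_int : 'M[int]_n :=
  \matrix_(i, j) xget 0 [set z : int | cartan_matrix alpha i j = z%:~R]%classic.

Lemma cartan_intE : cartan_matrix alpha = map_mx intr cartan_int.
Proof.
apply/matrixP => i j; rewrite [RHS]mxE [in RHS]mxE.
have [_ /(_ j) rootj _] := alpha_simple.
rewrite -(mulr1z (alpha j)) -root_of_coords_delta scale1r in rootj.
have [z zE _] := root_reflection_coords i rootj.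
case: xgetP => [z' _ //|/(_ z)]; case=> /=; rewrite zE (bigD1 j) //= big1 ?addr0 => [|k kj].
  by rewrite [delta_mx _ _ _ _]mxE !eqxx mulr1.
by rewrite [delta_mx _ _ _ _]mxE (negPf kj) mulr0.
Qed.

Lemma positive_root_simple i : positive_roots alpha (delta_mx i 0).
Proof.
have [_ /(_ i) rooti _] := alpha_simple; split=> [|j]; last by rewrite mxE ler0n.
by rewrite -[delta_mx i 0]scale1r root_of_coords_delta mulr1z.
Qed.

(** A positive root other than [alpha i] is not a multiple of [alpha i], so some
    other coordinate is positive.  The reflection does not change it, and the
    coordinates of a root all have the same sign. *)
Lemma positive_root_reflection i c :
    positive_roots alpha c -> c != delta_mx i 0 ->
  positive_roots alpha (c - (cartan_int *m c) i 0 *: delta_mx i 0).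
Proof.
move=> [rootc c_ge0] c_neq; have [z zE rootz] := root_reflection_coords i rootc.
have -> : (cartan_int *m c) i 0 = z.
  apply: (@intr_inj F); rewrite zE mxE rmorph_sum; apply: eq_bigr => j _ /=.
  by rewrite rmorphM cartan_intE [in RHS]mxE.
have [_ _ /(_ _ rootz)[c' /root_of_coords_inj c'E pos]] := alpha_simple.
split=> //; rewrite c'E; case: pos => // neg j.
suff [l li cl] : exists2 l, l != i & c l 0 != 0.
  have := neg l; rewrite -c'E !mxE (negPf li) mulr0 subr0 leNgt lt_neqAle eq_sym cl.
  by rewrite c_ge0.
apply: contrapT => no.
have cE : c = c i 0 *: delta_mx i 0.
  apply/colP => l; rewrite !mxE eqxx andbT.
  have [->|li] := eqVneq l i; first by rewrite mulr1.
  rewrite mulr0; apply: contrapT => /eqP cl; apply: no; by exists l.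
have := c_ge0 i; move: cE; case: (c i 0) => [m|//] cE _.
have [e [f [h [tr _ fH]]]] := simple_root_triple i.
have [phi0 [v v0 vP]] := rootc.
rewrite cE root_of_coords_delta in phi0 vP.
case: m cE phi0 vP => [|[|m]] cE phi0 vP.
- by rewrite mulr0z eqxx in phi0.
- by rewrite cE scale1r eqxx in c_neq.
by case/eqP: v0; apply: (root_multiple H_cartan tr fH vP).
Qed.

Lemma intr_bounded (es : seq F) :
  exists N : nat, forall z : int, z%:~R \in es -> (`|z| <= N)%N.
Proof.
elim: es => [|a es [N NP]]; first by exists 0%N.
have [[z zE]|no] := pselect (exists z : int, a = z%:~R); last first.
  by exists N => z; rewrite inE => /predU1P[za|/NP//]; case: no; exists z.
exists (maxn N `|z|) => y; rewrite inE zE eqr_int leq_max.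
by move=> /predU1P[->|/NP ->//]; rewrite leqnn orbT.
Qed.

(** Inverting the Cartan matrix yields vectors [hd j] of [H] dual to the simple
    roots; the coordinates of a root are its values at the [hd j], thus
    eigenvalues taken from finite lists. *)
Lemma positive_roots_finite : cartan_matrix alpha \in unitmx ->
  finite_set (positive_roots alpha).
Proof.
move=> unitA.
have /choice[hh hhP] : forall i, exists h, forall j, alpha j h = cartan_matrix alpha i j.
  by move=> i; have [e [f [h [_ ah _]]]] := simple_root_triple i; exists h.
pose hd j := \sum_i invmx (cartan_matrix alpha) j i *: hh i.
have hdE k j : alpha k (hd j) = (j == k)%:R :> F.
  rewrite linear_sum; have := mulVmx unitA => /matrixP/(_ j k); rewrite !mxE => <-.
  by apply: eq_bigr => i _; rewrite linearZ /= hhP.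
have coordE c j : root_of_coords alpha c (hd j) = (c j 0)%:~R :> F.
  rewrite root_of_coordsE (bigD1 j) //= hdE eqxx mulr1 big1 ?addr0 // => l lj.
  by rewrite hdE eq_sym (negPf lj) mulr0.
have /choice[N NP] : forall j, exists N : nat, forall c, is_root (root_of_coords alpha c) ->
    (`|c j 0%R| <= N)%N.
  move=> j; have [_ _ diagH] := H_cartan.
  have [es esP] := eigenvalues_finite (diagH _ (subvsP (hd j))).
  have [N NP] := intr_bounded es; exists N => c [_ [v v0 vP]].
  by apply/NP/(esP _ v) => //; rewrite vP coordE.
pose M := \max_j N j.
pose emb (u : 'cV['I_M.+1]_n) : 'cV[int]_n := \col_j (u j 0 : nat)%:Z.
apply: (@sub_finite_set _ _ (emb @` setT)%classic); last exact/finite_image/finite_finset.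
move=> c [rootc c_ge0] /=; exists (\col_j inord `|c j 0%R|%N) => //.
apply/colP => j; rewrite !mxE inordK ?gez0_abs // ltnS.
by apply: leq_trans (NP j c rootc) _; apply: leq_bigmax.
Qed.

End SimpleRoots.

(** * The sum of the positive roots *)

(** The reflection permutes the elements of [s] other than the [i]-th basis
    vector and changes the sign of [c |-> (C c)_i], so these terms cancel and the
    basis vector contributes [C i i]. *)
Lemma reflection_sum n (C : 'M[int]_n) (s : seq 'cV[int]_n) (i : 'I_n) :
    uniq s -> C i i = 2 -> delta_mx i 0 \in s -> - delta_mx i 0 \notin s ->
    (forall c, c \in s -> c != delta_mx i 0 ->
       c - (C *m c) i 0 *: delta_mx i 0 \in s) ->
  \sum_(c <- s) (C *m c) i 0 = 2.
Proof.
move=> uniq_s Cii si nsi refl_s.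
pose f (c : 'cV[int]_n) := (C *m c) i 0; pose sg c := c - f c *: delta_mx i 0.
have fdelta : f (delta_mx i 0) = 2 by rewrite /f -colE mxE.
have f_sg c : f (sg c) = - f c.
  have -> : f (sg c) = f c - f c * f (delta_mx i 0).
    by rewrite /sg /f mulmxBr -scalemxAr !mxE.
  rewrite fdelta; ring.
have sgK : involutive sg by move=> c; rewrite /sg f_sg scaleNr opprK addrNK.
have sg_delta : sg (delta_mx i 0) = - delta_mx i 0.
  by rewrite /sg fdelta -[X in X - _]scale1r -scalerBl -scaleN1r; congr (_ *: _).
rewrite (big_rem _ si) /= -/(f _) fdelta -/f.
set r := rem _ s; have mem_r c : c \in r = (c != delta_mx i 0) && (c \in s).
  by rewrite mem_rem_uniq // inE.
have uniq_r : uniq r by apply: rem_uniq.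
have perm_r : perm_eq (map sg r) r.
  apply: uniq_perm => // [|c]; first by rewrite map_inj_uniq //; apply: inv_inj sgK.
  have sgr d : d \in r -> sg d \in r.
    rewrite !mem_r => /andP[d_neq ds]; rewrite refl_s // andbT.
    apply: contraNneq nsi => sgd; rewrite -sg_delta -sgd sgK //.
  by apply/mapP/idP => [[d /sgr dr ->]//|/sgr cr]; exists (sg c); rewrite ?sgK.
have sumN : \sum_(c <- r) f c = - \sum_(c <- r) f c.
  rewrite -{1}(perm_big _ perm_r) /= big_map -sumrN.
  by apply: eq_bigr => c _; rewrite f_sg.
have -> : \sum_(c <- r) (C *m c) i 0 = 0 by rewrite -/f; move: sumN; rewrite /f; lia.
by rewrite addr0.
Qed.

(** * Inner products in coordinates *)

Section InnerProduct.
Variables (R : realType) (n : nat) (ip : 'cV[R]_n -> 'cV[R]_n -> R).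
Hypothesis ip_inner : inner_product ip.
Implicit Types (x y z : 'cV[R]_n).

Lemma ipC x y : ip x y = ip y x. Proof. by case: ip_inner. Qed.

Lemma ipDl x y z : ip (x + y) z = ip x z + ip y z.
Proof. by case: ip_inner => lin _ _; rewrite -[x]scale1r lin mul1r scale1r. Qed.

Lemma ip0l z : ip 0 z = 0.
Proof. by apply: (addrI (ip 0 z)); rewrite -ipDl !addr0. Qed.

Lemma ipZl a x z : ip (a *: x) z = a * ip x z.
Proof. by case: ip_inner => lin _ _; rewrite -[a *: x]addr0 lin ip0l addr0. Qed.

Lemma ipDr x y z : ip z (x + y) = ip z x + ip z y.
Proof. by rewrite ipC ipDl !(ipC z). Qed.

Lemma ipZr a x z : ip z (a *: x) = a * ip z x.
Proof. by rewrite ipC ipZl ipC. Qed.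

Lemma ipBl x y z : ip (x - y) z = ip x z - ip y z.
Proof. by rewrite -scaleN1r ipDl ipZl mulN1r. Qed.

Lemma ipBr x y z : ip z (x - y) = ip z x - ip z y.
Proof. by rewrite ipC ipBl !(ipC z). Qed.

Lemma ipNr x z : ip z (- x) = - ip z x.
Proof. by rewrite -scaleN1r ipZr mulN1r. Qed.

Lemma ip_ge0 x : 0 <= ip x x.
Proof.
case: ip_inner => _ _ pos; have [->|/pos/ltW//] := eqVneq x 0.
by rewrite ip0l.
Qed.

Lemma ip_eq0 x : ip x x = 0 -> x = 0.
Proof.
case: ip_inner => _ _ pos x0; apply: contrapT => /eqP/pos.
by rewrite x0 ltxx.
Qed.

Lemma ip_suml I (r : seq I) (E : I -> 'cV[R]_n) z :
  ip (\sum_(i <- r) E i) z = \sum_(i <- r) ip (E i) z.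
Proof.
elim: r => [|i r IHr]; first by rewrite !big_nil ip0l.
by rewrite !big_cons ipDl IHr.
Qed.

Lemma col_unit_vec x : x = \sum_i x i 0 *: unit_vec R i.
Proof.
apply/colP => l; rewrite summxE (bigD1 l) //= big1 => [|i li].
  by rewrite !mxE !eqxx mulr1 addr0.
by rewrite !mxE eq_sym (negPf li) mulr0.
Qed.

Lemma ip_coords x z : ip x z = \sum_i x i 0 * ip (unit_vec R i) z.
Proof. by rewrite {1}(col_unit_vec x) ip_suml; apply: eq_bigr => i _; rewrite ipZl. Qed.

Lemma ip_vec_eq x y : (forall i, ip (unit_vec R i) x = ip (unit_vec R i) y) -> x = y.
Proof.
move=> xy; apply/eqP; rewrite -subr_eq0; apply/eqP/ip_eq0.
by rewrite ip_coords big1 // => i _; rewrite ipBr xy subrr mulr0.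
Qed.

End InnerProduct.

(** * Dominant vectors and simple reflections *)

Section Reflections.
Variables (R : realType) (n : nat) (ip : 'cV[R]_n -> 'cV[R]_n -> R).
Hypothesis ip_inner : inner_product ip.
Variables (A : 'M[R]_n) (k : 'I_n -> nat).
Hypothesis ip_unit : forall i, ip (unit_vec R i) (unit_vec R i) = (k i)%:R.
Hypothesis k_gt0 : forall i, (0 < k i)%N.
Hypothesis ip_cartan : forall i x, 2%:R * ip (unit_vec R i) x = (k i)%:R * (A *m x) i 0.
Implicit Types (x y z u : 'cV[R]_n) (i j : 'I_n) (w : seq 'I_n).

Local Notation e := (unit_vec R).

Definition dominant y := forall i, 0 <= (A *m y) i 0.

Definition simple_refl i y := y - (A *m y) i 0 *: e i.

Lemma reflE i y l : simple_refl i y l 0 = y l 0 - (A *m y) i 0 * (l == i)%:R.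
Proof. by rewrite /simple_refl; set a := (A *m y) i 0; rewrite !mxE eqxx andbT. Qed.

(** The word [i_1 ... i_r] acts as [s_(i_1) ... s_(i_r)]: its last letter acts
    first. *)
Definition act w y := foldr simple_refl y w.

Lemma kR_gt0 i : 0 < (k i)%:R :> R. Proof. by rewrite ltr0n. Qed.

Lemma cartan_ip i x : (A *m x) i 0 = 2%:R * ip (e i) x / (k i)%:R.
Proof. by rewrite ip_cartan mulrAC divff ?mul1r // gt_eqF ?kR_gt0. Qed.

Lemma refl_ip i y : simple_refl i y = y - (2%:R * ip (e i) y / (k i)%:R) *: e i.
Proof. by rewrite /simple_refl cartan_ip. Qed.

Lemma refl_isometry i x y : ip (simple_refl i x) (simple_refl i y) = ip x y.
Proof.
have k0 : (k i)%:R != 0 :> R by rewrite gt_eqF ?kR_gt0.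
rewrite !refl_ip !(ipBl ip_inner, ipBr ip_inner, ipZl ip_inner, ipZr ip_inner).
by rewrite ip_unit (ipC ip_inner x (e i)); field.
Qed.

Lemma reflK i : involutive (simple_refl i).
Proof.
move=> y; have k0 : (k i)%:R != 0 :> R by rewrite gt_eqF ?kR_gt0.
rewrite !refl_ip (ipBr ip_inner) (ipZr ip_inner) ip_unit -addrA -opprD -scalerDl.
rewrite [X in X *: _](_ : _ = 0) ?scale0r ?subr0 //; field.
exact: k0.
Qed.

Lemma reflB i x y : simple_refl i (x - y) = simple_refl i x - simple_refl i y.
Proof.
rewrite /simple_refl; have -> : (A *m (x - y)) i 0 = (A *m x) i 0 - (A *m y) i 0.
  by rewrite mulmxBr !mxE.
by rewrite scalerBl !opprB addrACA [RHS]addrACA; congr (_ + _); exact: addrC.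
Qed.

Lemma act_cat w1 w2 y : act (w1 ++ w2) y = act w1 (act w2 y).
Proof. exact: foldr_cat. Qed.

Lemma act_revK w : cancel (act w) (act (rev w)).
Proof.
elim: w => //= i w IHw y; rewrite rev_cons -cats1 act_cat /= reflK.
exact: IHw.
Qed.

Lemma act_isometry w x y : ip (act w x) (act w y) = ip x y.
Proof. by elim: w => //= i w IHw; rewrite refl_isometry. Qed.

Lemma act_adjoint w x y : ip x (act w y) = ip (act (rev w) x) y.
Proof. by rewrite -(act_isometry (rev w)) act_revK. Qed.

(** Conjugating the reflection in [e i] by an isometry gives the reflection in the
    image of [e i]. *)
Lemma refl_conj w i j y : act w (e i) = e j ->
  simple_refl j (act w y) = act w (simple_refl i y).
Proof.
move=> wij; have actZB u a v : act w (u - a *: v) = act w u - a *: act w v.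
  elim: (w) => //= l w' ->; rewrite reflB; congr (_ - _).
  by rewrite /simple_refl -scalemxAr mxE scalerBr scalerA.
rewrite /simple_refl actZB wij; congr (_ - _ *: _).
rewrite !cartan_ip -wij act_isometry; congr (_ / _).
by rewrite -(ip_unit j) -wij act_isometry ip_unit.
Qed.

Variable P : set 'cV[R]_n.
Hypothesis P_ge0 : forall c, P c -> forall i, 0 <= c i 0.
Hypothesis P_simple : forall i, P (e i).
Hypothesis P_refl : forall i c, P c -> c != e i -> P (simple_refl i c).

(** A reflection in a word can make a root of [P] leave [P] only when the root has
    become the corresponding simple root [e j]. *)
Lemma act_root w c : P c -> P (act w c) \/
  exists w1 j w2, w = w1 ++ j :: w2 /\ act w2 c = e j.
Proof.
move=> Pc; elim: w => [|i w [Pw|[w1 [j [w2 [-> wj]]]]]]; first by left.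
  have [wi|/P_refl Pi] := eqVneq (act w c) (e i); last by left; apply: Pi.
  by right; exists [::], i, w.
by right; exists (i :: w1), j, w2.
Qed.

(** Here [act (rev w)] is the inverse of [act w].  If it does not keep [e i] in
    [P], then [act_root] applied to [rev w] finds a letter of [w] that cancels
    against the new reflection, by [refl_conj]. *)
Lemma exchange i w : P (act (rev w) (e i)) \/
  exists2 w', (size w' < size w)%N & forall y, simple_refl i (act w y) = act w' y.
Proof.
have [Pw|[w1 [j [w2 [wE wj]]]]] := act_root (rev w) (P_simple i); [by left | right].
rewrite -[w]revK wE; exists (rev w2 ++ rev w1) => [|y].
  by rewrite size_cat !size_rev size_cat /= addnS ltnS addnC.
rewrite rev_cat rev_cons -cats1 !act_cat /=.
apply: (can_inj (act_revK w2)).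
have wi : act (rev w2) (e j) = e i by rewrite -wj act_revK.
by rewrite (refl_conj _ wi) reflK.
Qed.

Lemma dominant_ip_root u c : dominant u -> P c -> 0 <= ip c u.
Proof.
move=> dom Pc; rewrite (ip_coords ip_inner) sumr_ge0 // => i _.
rewrite mulr_ge0 ?P_ge0 // -(pmulr_rge0 _ (ltr0n R 2)) ip_cartan.
by rewrite mulr_ge0 ?ler0n ?dom.
Qed.

(** Induction on the length of the word.  A further reflection [s_i] lowers
    [w u] unless [<w u, e_i> < 0]; since this is [<u, w^-1 e_i>] and [u] is
    dominant, [w^-1 e_i] is then not in [P], and by the exchange property a shorter
    word has the same effect. *)
Lemma dominant_highest u w : dominant u -> le_vec (act w u) u.
Proof.
move=> dom; have [N] := ubnP (size w); elim: N w => // N IHN [_ l //|i w /= /ltnSE size_w].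
have IHw : le_vec (act w u) u by apply: IHN.
have [a_ge0|a_lt0] := leP 0 ((A *m act w u) i 0).
  by move=> l; apply: le_trans (IHw l); rewrite reflE gerBl mulr_ge0 // ler0n.
have [Pw|[w' size_w' w'E]] := exchange i w; last first.
  by rewrite w'E; apply: IHN; apply: leq_trans size_w' _; apply: ltnW.
have := dominant_ip_root dom Pw; rewrite -act_adjoint.
rewrite -(pmulr_rge0 _ (ltr0n R 2)) ip_cartan pmulr_rge0 ?kR_gt0 //.
by rewrite leNgt a_lt0.
Qed.

Lemma dominant_unique u w : dominant u -> dominant (act w u) -> act w u = u.
Proof.
move=> dom dom_w; apply/colP => l; apply/le_anti; rewrite (dominant_highest w dom) /=.
by have := dominant_highest (rev w) dom_w l; rewrite act_revK.
Qed.

End Reflections.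

Local Open Scope classical_set_scope.
Local Open Scope complex_scope.

(** * Orbits on the primary ellipsoid *)

Section Orbits.
Variables (R : realType) (n : nat) (ip : 'cV[R]_n -> 'cV[R]_n -> R).
Hypothesis ip_inner : inner_product ip.
Variables (C : 'M[int]_n) (k : 'I_n -> nat).
Local Notation A := (map_mx intr C : 'M[R]_n).
Hypothesis ip_unit : forall i, ip (unit_vec R i) (unit_vec R i) = (k i)%:R.
Hypothesis k_gt0 : forall i, (0 < k i)%N.
Hypothesis ip_cartan : forall i x, 2%:R * ip (unit_vec R i) x = (k i)%:R * (A *m x) i 0.
Variable delta : 'cV[R]_n.
Hypothesis A_delta : A *m delta = const_mx 1.
Variable P : set 'cV[R]_n.
Hypothesis P_ge0 : forall c, P c -> forall i, 0 <= c i 0.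
Hypothesis P_simple : forall i, P (unit_vec R i).
Hypothesis P_refl : forall i c, P c -> c != unit_vec R i -> P (simple_refl A i c).

Implicit Types (y z u : 'cV[R]_n) (i j : 'I_n) (w : seq 'I_n).
Local Notation e := (unit_vec R).
Local Notation PE := (PE ip delta).
Local Notation PD := (PD ip delta).
Local Notation WPE := (@WPE R n ip delta).
Local Notation orbit := (@orbit_WPE R n ip delta).
(* The action of a word on the ellipsoid itself, centred at [delta]. *)
Local Notation wact w y := (delta - act A w (delta - y)).

Lemma cartan_delta i : (A *m delta) i 0 = 1. Proof. by rewrite A_delta mxE. Qed.

Lemma cartan_subl i y : (A *m (delta - y)) i 0 = 1 - (A *m y) i 0.
Proof. by rewrite mulmxBr A_delta !mxE. Qed.

Lemma cartan_unitmx : A \in unitmx.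
Proof.
have A_inj y : A *m y = 0 -> y = 0.
  move=> Ay0; apply: (ip_vec_eq ip_inner) => i; apply: (mulfI (x := 2%:R)).
    by rewrite pnatr_eq0.
  by rewrite !ip_cartan Ay0 mulmx0.
rewrite -unitmx_tr -row_free_unit -kermx_eq0; apply/eqP/row_matrixP => i.
rewrite row0; apply: trmx_inj; rewrite trmx0; apply: A_inj.
by apply: trmx_inj; rewrite trmx_mul trmxK -row_mul mulmx_ker row0 trmx0.
Qed.

(** The equation of the ellipsoid restricted to the line through [y] in the
    direction [e i], divided by [k i]. *)
Lemma PE_line i y h : PE y ->
  PE (y + h *: e i) <-> h * (h - (1 - (A *m y) i 0)) = 0.
Proof.
rewrite /Defs.PE /= => PEy.
have -> : ip (y + h *: e i) (y + h *: e i - 2%:R *: delta) =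
    (k i)%:R * (h * (h - (1 - (A *m y) i 0))).
  have := ip_cartan i y; have := ip_cartan i delta; rewrite cartan_delta mulr1.
  move: PEy; rewrite !(ipDl ip_inner, ipDr ip_inner, ipNr ip_inner, ipZl ip_inner,
    ipZr ip_inner) ip_unit (ipC ip_inner y (e i)) => PEy id iy.
  have -> : ip (e i) delta = (k i)%:R / 2%:R by lra.
  have -> : ip (e i) y = (k i)%:R * (A *m y) i 0 / 2%:R by lra.
  lra.
split=> [/eqP|->]; last by rewrite mulr0.
by rewrite mulf_eq0 gt_eqF ?ltr0n ?k_gt0 //= => /eqP.
Qed.

(** The second root of the equation in [PE_line]; when it is 0 the line is tangent
    and the default value of [step] agrees with it. *)
Lemma stepE i y : PE y -> step ip delta y i = 1 - (A *m y) i 0.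
Proof.
move=> PEy; rewrite /step; case: xgetP => [h _ [h0 /(PE_line _ _ PEy)/eqP]|no].
  by rewrite mulf_eq0 (negPf h0) subr_eq0 => /eqP.
apply: contrapT => /eqP h0; apply: (no (1 - (A *m y) i 0)).
by split; [rewrite eq_sym | apply/(PE_line _ _ PEy); rewrite subrr mulr0].
Qed.

Lemma val_Tmap i (x : PE) : val (Tmap i x) = wact [:: i] (val x).
Proof.
rewrite /= stepE; last exact/set_mem/valP.
by rewrite /simple_refl cartan_subl opprB addrCA subKr addrC.
Qed.

(** The generators are involutions, so inverses are given by reversed words. *)
Lemma WPE_word g : WPE g -> exists w, forall x, val (g x) = wact w (val x).
Proof.
elim=> [i||f h _ [w wE] _ [w' w'E]|f h _ [w wE] fK hK].
- by exists [:: i] => x; apply: val_Tmap.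
- by exists [::] => x; rewrite /= subKr.
- by exists (w ++ w') => x; rewrite /= wE w'E act_cat subKr.
exists (rev w) => x; rewrite -[in RHS](hK x) wE subKr.
by rewrite (act_revK ip_inner ip_unit k_gt0 ip_cartan) subKr.
Qed.

Lemma word_WPE w : exists2 g, WPE g & forall x, val (g x) = wact w (val x).
Proof.
elim: w => [|i w [g Wg gE]].
  by exists id => [|x]; [exact: WPE_id | rewrite /= subKr].
exists (Tmap i \o g) => [|x]; first by apply: WPE_comp => //; exact: WPE_gen.
by rewrite [LHS]val_Tmap gE subKr.
Qed.

Lemma orbitP (x : PE) y : orbit x y <-> exists w, y = wact w (val x).
Proof.
split=> [[g /WPE_word[w wE] ->]|[w ->]]; first by exists w.
by have [g Wg gE] := word_WPE w; exists g.
Qed.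

Lemma orbit_eq (x z : PE) : orbit x (val z) -> orbit x = orbit z.
Proof.
move=> /orbitP[w zE]; apply/seteqP; split=> y /orbitP[v ->]; apply/orbitP.
- exists (v ++ rev w); rewrite zE act_cat subKr.
  by rewrite (act_revK ip_inner ip_unit k_gt0 ip_cartan).
- by exists (v ++ w); rewrite zE act_cat subKr.
Qed.

Lemma orbit_refl (x : PE) : orbit x (val x).
Proof. by apply/orbitP; exists [::]; rewrite /= subKr. Qed.

Lemma wact_cons i w y : wact (i :: w) y = wact w y + (1 - (A *m wact w y) i 0) *: e i.
Proof. by rewrite /= /simple_refl -cartan_subl subKr opprB addrA addrAC. Qed.

Lemma integral_cartan y i : integral_vec y -> (A *m y) i 0 \is a Num.int.
Proof.
move=> y_int; rewrite mxE rpred_sum // => j _; rewrite rpredM // mxE.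
exact: intr_int.
Qed.

Lemma integral_wact w y : integral_vec y -> integral_vec (wact w y).
Proof.
elim: w => [|i w IHw] y_int; first by rewrite /= subKr.
have {}IHw := IHw y_int.
rewrite wact_cons => l; move: (integral_cartan i IHw) (IHw l); move: (wact w y) => z.
set a := (A *m z) i 0 => a_int z_int.
by rewrite !mxE rpredD // rpredM ?rpredB ?rpred1 ?rpred_nat.
Qed.

Lemma PD_WPE g (x : PE) : WPE g -> PD (val x) -> PD (val (g x)).
Proof.
move=> /WPE_word[w wE] [_ x_int]; split; first exact/set_mem/valP.
by rewrite wE; apply: integral_wact.
Qed.

Lemma PD_orbit (x : PE) y : PD (val x) -> orbit x y -> PD y.
Proof. by move=> PDx [g Wg ->]; apply: PD_WPE. Qed.

(** On the ellipsoid [<y, y> = 2 <delta, y>], and [2 <delta, e_i> = k_i]. *)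
Lemma PE_norm y : PE y -> ip y y = \sum_i (k i)%:R * y i 0.
Proof.
rewrite /Defs.PE /= (ipBr ip_inner) (ipZr ip_inner) => /eqP; rewrite subr_eq0 => /eqP ->.
rewrite (ip_coords ip_inner) mulr_sumr; apply: eq_bigr => i _.
by rewrite mulrCA ip_cartan cartan_delta mulr1 mulrC.
Qed.

(** While some [1 - (A x)_i] is negative, it is an integer at most [-1], and
    applying [T_i] lowers the nonnegative quantity of [PE_norm] by at
    least 1. *)
Lemma orbit_dominant (x : PE) : PD (val x) ->
  exists z : PE, orbit x (val z) /\ dominant A (delta - val z).
Proof.
have [N] : exists N : nat, \sum_i (k i)%:R * val x i 0 < N%:R :> R.
  exists (Num.bound `|\sum_i (k i)%:R * val x i 0|).
  exact: le_lt_trans (ler_norm _) (archi_boundP (normr_ge0 _)).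
elim: N x => [|N IHN] x sum_lt PDx.
  have : 0 <= ip (val x) (val x) by apply: ip_ge0.
  by rewrite PE_norm ?leNgt ?sum_lt //; case: PDx.
have [dom|/existsNP[i /negP]] := pselect (dominant A (delta - val x)).
  by exists x; split=> //; apply: orbit_refl.
rewrite -ltNge cartan_subl => neg.
have orb : orbit x (val (Tmap i x)) by exists (Tmap i) => //; apply: WPE_gen.
have [|//|z [zorb zdom]] := IHN (Tmap i x); last 1 first.
- by exists z; rewrite (orbit_eq orb).
- have -> : \sum_l (k l)%:R * val (Tmap i x) l 0 =
      \sum_l (k l)%:R * val x l 0 + (k i)%:R * (1 - (A *m val x) i 0).
    rewrite val_Tmap wact_cons /= subKr; set c := 1 - _.
    rewrite (eq_bigr (fun l => (k l)%:R * val x l 0 + (k l)%:R * c * (l == i)%:R)).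
      rewrite big_split /=; congr (_ + _); rewrite (bigD1 i) //= eqxx mulr1.
      by rewrite big1 ?addr0 // => l /negPf->; rewrite mulr0.
    by move=> l _; rewrite !mxE eqxx andbT mulrDr mulrA.
  have c_int : 1 - (A *m val x) i 0 \is a Num.int.
    by rewrite rpredB ?rpred1 // integral_cartan //; case: PDx.
  have c_le : 1 - (A *m val x) i 0 <= -1.
    by move: neg; case/intrP: c_int => z ->; rewrite -[-1]/((-1)%:~R) ltrz0 ler_int; lia.
  have k_ge1 : 1 <= (k i)%:R :> R by rewrite ler1n.
  move: sum_lt; rewrite -[N.+1]addn1 natrD; nra.
- exact: PD_orbit orb.
Qed.


(** The vector [h] attached to an orbit: nonnegativity of [h] says that
    [delta - y] is dominant, so a suitable [y] exists and is unique in the orbits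
    of integral points. *)
Definition code (O : set 'cV[R]_n) : 'cV[int]_n :=
  xget 0 [set h : 'cV[int]_n | (forall i, 0 <= h i 0) /\
    exists2 y, O y & map_mx intr h = A *m (delta - y)].

Lemma dominant_orbit_unique (x : PE) y z : orbit x y -> orbit x z ->
  dominant A (delta - y) -> dominant A (delta - z) -> y = z.
Proof.
move=> /orbitP[v ->] /orbitP[w ->]; rewrite !subKr => dom_v dom_w.
congr (_ - _); have := dominant_unique ip_inner ip_unit k_gt0 ip_cartan P_ge0
  P_simple P_refl (w := w ++ rev v) dom_v.
by rewrite act_cat (act_revK ip_inner ip_unit k_gt0 ip_cartan) => /(_ dom_w) ->.
Qed.

Lemma dominant_orbit_least (x : PE) y z : orbit x y -> orbit x z ->
  dominant A (delta - y) -> le_vec y z.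
Proof.
move=> /orbitP[v ->] /orbitP[w ->]; rewrite subKr => dom_v l.
have := dominant_highest ip_inner ip_unit k_gt0 ip_cartan P_ge0
  P_simple P_refl (w ++ rev v) dom_v l.
rewrite act_cat (act_revK ip_inner ip_unit k_gt0 ip_cartan) !mxE => le_wv.
by rewrite lerD2l lerN2.
Qed.

Lemma code_eq (x : PE) y (h : 'cV[int]_n) : orbit x y -> (forall i, 0 <= h i 0) ->
  map_mx intr h = A *m (delta - y) -> code (orbit x) = h.
Proof.
move=> xy h_ge0 hE; have dom z (g : 'cV[int]_n) : (forall i, 0 <= g i 0) ->
    map_mx intr g = A *m (delta - z) -> dominant A (delta - z).
  by move=> g_ge0 gE i; rewrite -gE mxE ler0z.
rewrite /code; case: xgetP => [g _ [g_ge0 [z xz gE]]|/(_ h)[]]; last by split=> //; exists y.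
have yz : y = z by apply: dominant_orbit_unique xy xz _ _; [apply: dom hE|apply: dom gE].
apply/colP => i; apply: (@intr_inj R).
by move: gE; rewrite -yz -hE => /colP/(_ i); rewrite !mxE.
Qed.

Lemma code_spec (x : PE) : PD (val x) -> exists z : PE,
  [/\ orbit x (val z), forall i, 0 <= code (orbit x) i 0
    & map_mx intr (code (orbit x)) = A *m (delta - val z)].
Proof.
move=> PDx; have [z [xz dom_z]] := orbit_dominant PDx.
have [_ z_int] := PD_orbit PDx xz.
have /choice[h hE] : forall i, exists h : int, (A *m (delta - val z)) i 0 = h%:~R.
  by move=> i; apply/intrP; rewrite cartan_subl rpredB ?rpred1 ?integral_cartan.
pose g : 'cV[int]_n := \col_i h i.
have gE : map_mx intr g = A *m (delta - val z) by apply/colP => i; rewrite !mxE -hE mxE.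
have g_ge0 i : 0 <= g i 0 by rewrite mxE -(ler0z R) -hE.
by exists z; rewrite (code_eq xz g_ge0 gE).
Qed.

(** Up to a factor 2, both sides are the inner product of columns [i] and [j] of
    the inverse matrix. *)
Lemma weighted_inverse_sym i j :
  (k i)%:R * invmx A i j = (k j)%:R * invmx A j i.
Proof.
have colE l m : 2%:R * ip (e l) (col m (invmx A)) = (k l)%:R * (l == m)%:R.
  by rewrite ip_cartan colE mulmxA mulmxV ?cartan_unitmx // mul1mx mxE andbT.
have ipE l m : 2%:R * ip (col l (invmx A)) (col m (invmx A)) = (k m)%:R * invmx A m l.
  rewrite (ip_coords ip_inner) mulr_sumr (bigD1 m) //= big1 => [|p /negPf pm].
    by rewrite mulrCA colE eqxx mulr1 addr0 mulrC mxE.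
  by rewrite mulrCA colE pm !mulr0.
by rewrite -ipE (ipC ip_inner) ipE.
Qed.

Lemma ip_invmx u : 2%:R * ip (invmx A *m u) (invmx A *m u) =
  \sum_i \sum_j (k i)%:R * invmx A i j * (u i 0 * u j 0).
Proof.
rewrite (ip_coords ip_inner) mulr_sumr; apply: eq_bigr => i _.
rewrite mulrCA ip_cartan mulmxA mulmxV ?cartan_unitmx // mul1mx mxE mulr_suml.
by apply: eq_bigr => j _; ring.
Qed.

(** With [u = A (delta - x)], the secondary equation is twice the primary equation
    at [x]: both compare the form of [ip_invmx] at [u] and at [(1, ..., 1)],
    the latter being [A delta]. *)
Lemma secondary_ellipsoidE u :
  secondary_ellipsoid A k u <-> PE (delta - invmx A *m u).
Proof.
have deltaE : delta = invmx A *m const_mx 1 by rewrite -A_delta mulKmx ?cartan_unitmx.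
pose B i j := (k i)%:R * invmx A i j * (u i 0 * u j 0 - 1).
have BC i j : B i j = B j i by rewrite /B weighted_inverse_sym [u i 0 * _]mulrC.
have -> : secondary_ellipsoid A k u <-> \sum_i \sum_j B i j = 0.
  rewrite /secondary_ellipsoid /=.
  have -> : \sum_i \sum_j B i j = (\sum_(i < n) (k i)%:R * invmx A i i * (u i 0 ^+ 2 - 1))
    + 2%:R * (\sum_(i < n) \sum_(j < n | (i < j)%N)
                (k i)%:R * invmx A i j * (u i 0 * u j 0 - 1)); last by [].
  have split_sum i : \sum_j B i j = B i i
      + (\sum_(j < n | (i < j)%N) B i j + \sum_(j < n | (j < i)%N) B i j).
    rewrite (bigD1 i) //= (bigID (fun j : 'I_n => (i < j)%N)) /=; congr (_ + (_ + _)).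
      by apply: eq_bigl => j; rewrite andbC; case: ltnP => //= ij; rewrite -val_eqE /= gtn_eqF.
    by apply: eq_bigl => j; rewrite -leqNgt -val_eqE /= ltn_neqAle.
  under eq_bigr => i _ do rewrite split_sum.
  rewrite 2!big_split /=; congr (_ + _); rewrite mulr_natl mulr2n; congr (_ + _).
  rewrite (exchange_big_dep xpredT) //=; apply: eq_bigr => i _.
  by apply: eq_bigr => j _; rewrite BC.
have -> : \sum_i \sum_j B i j =
    2%:R * ip (delta - invmx A *m u) (delta - invmx A *m u - 2%:R *: delta).
  transitivity (2%:R * ip (invmx A *m u) (invmx A *m u) - 2%:R * ip delta delta).
    rewrite [in X in _ - X]deltaE !ip_invmx -sumrB; apply: eq_bigr => i _.
    rewrite -sumrB; apply: eq_bigr => j _; rewrite !mxE /B; ring.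
  move: (invmx A *m u) => y; rewrite scaler_nat mulr2n opprD addrACA subrr add0r.
  rewrite !(ipBl ip_inner, ipDr ip_inner, ipNr ip_inner) (ipC ip_inner y delta); ring.
split=> [/eqP|]; last by rewrite /Defs.PE /= => ->; rewrite mulr0.
by rewrite mulf_eq0 pnatr_eq0 /= => /eqP.
Qed.

Lemma x_ofE (h : 'cV[int]_n) : x_of A h = delta - invmx A *m map_mx intr h.
Proof. by rewrite /x_of mulmxBr -A_delta mulKmx ?cartan_unitmx. Qed.

(** The classification of orbits for any [C], [delta] and [P] with the three
    properties of the root system; [P] stands for the set of positive roots. *)
Theorem orbits_classified :
  let Orb := orbits_PD ip delta in
  let Hset := secondary_solutions A k in
  (forall (g : PE -> PE) (x : PE), WPE g -> PD (val x) -> PD (val (g x))) /\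
  (PD = \bigcup_(O in Orb) O) /\
  (forall O1 O2, Orb O1 -> Orb O2 -> O1 `&` O2 !=set0 -> O1 = O2) /\
  (exists (S : set 'cV[int]_n) (f : set 'cV[R]_n -> 'cV[int]_n),
     [/\ S `<=` Hset,
         set_bij Orb S f
       & forall h : 'cV[int]_n, Hset h -> integral_vec (x_of A h) ->
           exists O : set 'cV[R]_n,
             [/\ Orb O, f O = h & unique_minimal_in O (x_of A h)]]).
Proof.
move=> Orb Hset.
have orbits_meet (x x' : PE) y : orbit x y -> orbit x' y -> orbit x = orbit x'.
  move=> [g Wg ->] x'y; rewrite (orbit_eq (x := x) (z := g x)); last by exists g.
  by rewrite -(orbit_eq x'y).
split; first exact: PD_WPE.
split.
  apply/seteqP; split=> [y PDy|y [O [x PDx ->]]]; last exact: PD_orbit.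
  have PEy : y \in PE by apply/mem_set; case: PDy.
  pose x : PE := exist (fun z => z \in PE) y PEy.
  by exists (orbit x); [exists x | apply: (orbit_refl x)].
split.
  by move=> _ _ [x PDx ->] [x' PDx' ->] [y [xy x'y]]; apply: orbits_meet xy x'y.
exists (code @` Orb), code; split.
- move=> _ [_ [x PDx ->] <-]; have [z [xz code_ge0 codeE]] := code_spec PDx.
  split=> //; apply/secondary_ellipsoidE; rewrite codeE mulKmx ?cartan_unitmx // subKr.
  exact/set_mem/valP.
- split=> [O OrbO|_ _ /set_mem[x PDx ->] /set_mem[x' PDx' ->] codeE|h [O OrbO <-]].
  + by exists O.
  + have [z [xz _ zE]] := code_spec PDx; have [z' [xz' _ zE']] := code_spec PDx'.
    suff zz' : val z = val z' by rewrite zz' in xz; apply: orbits_meet xz xz'.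
    move: zE; rewrite codeE zE' => /(can_inj (mulKmx cartan_unitmx))/addrI/oppr_inj.
    by move=> ->.
  + by exists O.
move=> h [h_ge0 /secondary_ellipsoidE]; rewrite -x_ofE => /mem_set PEh h_int.
pose x : PE := exist (fun z => z \in PE) (x_of A h) PEh.
have PDx : PD (val x) by split=> //; apply: set_mem PEh.
have hE : map_mx intr h = A *m (delta - val x).
  by rewrite /= x_ofE subKr mulKVmx ?cartan_unitmx.
have xx := orbit_refl x.
have dom : dominant A (delta - val x) by move=> i; rewrite -hE mxE ler0z.
have least y : orbit x y -> le_vec (x_of A h) y.
  by move=> xy; apply: dominant_orbit_least xx xy dom.
exists (orbit x); split; [by exists x | exact: code_eq xx h_ge0 hE | split].
  split=> // y xy y_le; apply/colP => l; apply/le_anti.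
  by rewrite y_le least.
by move=> y [xy min_y]; rewrite (min_y (x_of A h)) //; apply: least.
Qed.

End Orbits.

(** * From the Lie algebra to the ellipsoid *)

Theorem theorem3p2 (R : realType) (L : lieAlgType R[i])
    (L_semisimple : semisimple L)
    (H : {vspace L}) (H_cartan : cartan_subalgebra H)
    (n : nat) (alpha : 'I_n -> 'Hom(subvs_of H, R[i]^o))
    (alpha_simple : simple_roots alpha)
    (A : 'M[R]_n) (A_cartan : map_mx (real_complex R) A = cartan_matrix alpha)
    (k : 'I_n -> nat) (k_weights : dynkin_weights alpha k)
    (ip : 'cV[R]_n -> 'cV[R]_n -> R) (ip_inner : inner_product ip)
    (ip_cartan : forall i j : 'I_n,
      2%:R * ip (unit_vec R i) (unit_vec R j)
        / ip (unit_vec R i) (unit_vec R i) = A i j)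
    (ip_normalized : forall i : 'I_n,
      ip (unit_vec R i) (unit_vec R i) = (k i)%:R) :
  let delta := half_sum_positive_roots alpha in
  let Orb := orbits_PD ip delta in
  let Hset := secondary_solutions A k in
  (* PD is invariant under WPE *)
  (forall (g : PE ip delta -> PE ip delta) (x : PE ip delta),
     WPE g -> PD ip delta (val x) -> PD ip delta (val (g x))) /\
  (* PD is the disjoint union of its orbits *)
  (PD ip delta = \bigcup_(O in Orb) O) /\
  (forall O1 O2, Orb O1 -> Orb O2 -> O1 `&` O2 !=set0 -> O1 = O2) /\
  (* orbits correspond bijectively to a subset of H *)
  (exists (S : set 'cV[int]_n) (f : set 'cV[R]_n -> 'cV[int]_n),
     [/\ S `<=` Hset,
         set_bij Orb S f
       & forall h : 'cV[int]_n, Hset h -> integral_vec (x_of A h) ->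
           exists O : set 'cV[R]_n,
             [/\ Orb O, f O = h & unique_minimal_in O (x_of A h)]]).
Proof.
have [k_in _ _] := k_weights.
have k_gt0 i : (0 < k i)%N by have := k_in i; rewrite !inE => /or3P[] /eqP ->.
have kR_neq0 i : (k i)%:R != 0 :> R by rewrite pnatr_eq0 -lt0n.
have cartan_diag i : cartan_matrix alpha i i = 2%:R.
  rewrite -A_cartan mxE -ip_cartan ip_normalized mulfK //.
  by rewrite -(rmorph_nat (real_complex R)).
pose C := cartan_int alpha.
have AE : A = map_mx intr C.
  have := cartan_intE L_semisimple H_cartan alpha_simple cartan_diag.
  rewrite -A_cartan => /matrixP AC; apply/matrixP => i j.
  have := AC i j; rewrite !mxE => ACij; apply: (@fmorph_inj _ _ (real_complex R)).
  exact: etrans ACij (esym (rmorph_int _ _)).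
have ip_coroot i x :
    2%:R * ip (unit_vec R i) x = (k i)%:R * (map_mx intr C *m x) i 0.
  rewrite -AE (ipC ip_inner) (ip_coords ip_inner) mxE !mulr_sumr.
  apply: eq_bigr => j _; rewrite -ip_cartan ip_normalized (ipC ip_inner).
  by field.
have unitA : cartan_matrix alpha \in unitmx.
  by rewrite -A_cartan AE map_unitmx (cartan_unitmx ip_inner ip_coroot).
have finP := positive_roots_finite L_semisimple H_cartan alpha_simple cartan_diag unitA.
have reflP i := @positive_root_reflection _ _ _ L_semisimple H_cartan _ _
  alpha_simple cartan_diag i.
have simpleP := positive_root_simple alpha_simple.
move=> delta.
have A_delta : map_mx intr C *m delta = const_mx 1.
  apply/colP => i; rewrite [RHS]mxE.
  rewrite /delta /half_sum_positive_roots fsbig_finite // -scalemxAr mxE.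
  rewrite mulmx_sumr summxE.
  under eq_bigr => c _ do rewrite -map_mxM mxE.
  rewrite -rmorph_sum reflection_sum ?fset_uniq //.
  - by apply: mulVf; rewrite pnatr_eq0.
  - have := cartan_diag i; rewrite -A_cartan AE !mxE => Cii.
    apply: (@intr_inj R[i]); rewrite -[RHS]Cii; exact: esym (rmorph_int _ _).
  - by rewrite in_fset_set // mem_set.
  - rewrite in_fset_set //; apply/negP => /set_mem[_ /(_ i)].
    by rewrite !mxE !eqxx.
  - move=> c; rewrite !in_fset_set // => /set_mem Pc c_neq.
    exact/mem_set/reflP.
rewrite AE; pose P := map_mx intr @` positive_roots alpha : set 'cV[R]_n.
apply: (@orbits_classified _ _ _ ip_inner _ _ ip_normalized k_gt0 ip_coroot _ A_delta P).
- by move=> _ [c [_ c_ge0] <-] i; rewrite mxE ler0z.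
- by move=> i; exists (delta_mx i 0) => //; rewrite map_delta_mx.
- move=> i _ [c Pc <-] c_neq; exists (c - (C *m c) i 0 *: delta_mx i 0).
    by apply: reflP => //; apply: contraNneq c_neq => ->; rewrite map_delta_mx.
  by rewrite /simple_refl -map_mxM [(map_mx _ _) i 0]mxE map_mxB map_mxZ map_delta_mx.
Qed.
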